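(* Fix an integer $q\geq2$. Let $F\subseteq\Delta_q$ be a (possibly infinite) non-empty subset of $\mathbb{N}^q$, let $b=(b_i)_{i\ge1}\in\ell^2(\mathbb{N})$, and assume that $\mu_b^{\otimes q}(F)>0$. Let $S^{(b)}(F)$ be the random variable $$S^{(b)}(F):=\frac{1}{(q!\,\mu_b^{\otimes q}(F))^{1/2}}\sum_{(i_1,\ldots,i_q)\in F}b_{i_1}\cdots b_{i_q}\,X_{i_1}\cdots X_{i_q},$$ and let $N$ be a standard Gaussian random variable. Then there are constants $0<C_1,C_2<\infty$ only depending on $q$ such that $$d_K(S^{(b)}(F),N)\leq C_1\,\Phi^{(b)}(F)+C_2\,\Big(\sup_{j\geq 1}\Psi_j^{(b)}(F)\Big)^{1/4}.$$
   Context: $(X_i)_{i\ge1}$ is a Rademacher sequence: i.i.d. with $P(X_i=\pm1)=\frac12$. $\Delta_q=\{(i_1,\dots,i_q)\in\mathbb{N}^q: i_k\ne i_l\text{ for }k\neq l\}$. $\mu_b$ is the measure on $\mathbb{N}$ with $\mu_b(B)=\sum_{i\in B}b_i^2$ for $B\subset\mathbb{N}$, and $\mu_b^{\otimes m}$ is its $m$-fold product measure. $F_j^*$ is the collection of all $(i_1,\dots,i_q)\in F$ such that $i_k=j$ for some $k\in\{1,\dots,q\}$. $F^\sharp\subset F\times F$ is defined as follows: a pair $((i_1,\dots,i_q),(j_1,\dots,j_q))$ belongs to $F^\sharp$ if $\{i_1,\dots,i_q\}\cap\{j_1,\dots,j_q\}=\emptyset$ and there are $(k_1,\dots,k_q),(l_1,\dots,l_q)\in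 F$ such that $\{k_1,\dots,k_q,l_1,\dots,l_q\}=\{i_1,\dots,i_q,j_1,\dots,j_q\}$ with the property that $(k_1,\dots,k_q)$ does not coincide with $(i_1,\dots,i_q)$ or $(j_1,\dots,j_q)$. Put $$\Phi^{(b)}(F)=\frac{\mu_b^{\otimes 2q}(F^\sharp)^{1/2}}{\mu_b^{\otimes q}(F)},\qquad\Psi_j^{(b)}(F)=\frac{\mu_b^{\otimes q}(F_j^* )}{\mu_b^{\otimes q}(F)}.$$ The Kolmogorov distance is $d_K(S,N)=\sup_{x\in\mathbb{R}}|P(S\le x)-P(N\le x)|$.
   Formalization: F is additionally assumed symmetric (closed under permuting coordinates); without this the bound fails, e.g. q=2, F={(2i-1,2i): i≤n}, b=1 on {1,…,2n} and 0 elsewhere, where S tends to N(0,1/2) while the right-hand side tends to 0. *)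

(* Defs.v *)
From HB Require Import structures.
From mathcomp Require Import all_boot all_order all_algebra.
From mathcomp Require Import finmap.
From mathcomp Require Import all_classical all_reals all_analysis.
From mathcomp.analysis.showcase Require summability.

Set Implicit Arguments.
Unset Strict Implicit.
Unset Printing Implicit Defensive.
Import Order.TTheory GRing.Theory Num.Theory.
Import numFieldNormedType.Exports.
Local Open Scope classical_set_scope.
Local Open Scope ring_scope.

(* Sequences indexed by the positive integers are indexed here by nat, i.e.
   from 0; a point of N^q is a q.-tuple nat. *)

Section weighted_measure.
Context {R : realType}.
Variable b : nat -> R.

Definition square_summable : Prop :=
  cvg (series (fun i => b i ^+ 2) @ \oo).

Definition mu_b (B : set nat) : \bar R := (\esum_(i in B) (b i ^+ 2)%:E)%E.

(* The m-fold product of the discrete measure mu_b is again discrete: it gives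
   the point (t_1, ..., t_m) the mass b_{t_1}^2 ... b_{t_m}^2.  Lemma
   [mu_pow_rect] below checks the defining property on rectangles. *)
Definition mu_pow (m : nat) (A : set (m.-tuple nat)) : \bar R :=
  (\esum_(t in A) (\prod_(i <- t) b i ^+ 2)%:E)%E.

End weighted_measure.

Section mu_pow_rect.
Context {R : realType}.
Local Open Scope ereal_scope.

Let esumZle (T : choiceType) (A : set T) (f : T -> \bar R) (c : R) :
  (0 <= c)%R -> (forall t, 0 <= f t) ->
  \esum_(t in A) (c%:E * f t) <= c%:E * \esum_(t in A) f t.
Proof.
move=> c0 f0; apply: ge_ereal_sup => _ [X XA <-].
rewrite -ge0_mule_fsumr//; apply: lee_pmul => //.
  by apply: fsume_ge0 => // ? _.
by apply: ereal_sup_ubound; exists X.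
Qed.

Let esumZl (T : choiceType) (A : set T) (f : T -> \bar R) (c : R) :
  (0 <= c)%R -> (forall t, 0 <= f t) ->
  \esum_(t in A) (c%:E * f t) = c%:E * \esum_(t in A) f t.
Proof.
move=> c0 f0; apply/eqP; rewrite eq_le esumZle//=.
have [->|cn0] := eqVneq c 0%R.
  by rewrite mul0e esum_ge0// => t _; rewrite mul0e.
have cp : (0 < c)%R by rewrite lt_neqAle eq_sym cn0.
rewrite -lee_pdivlMl//; apply: le_trans (esumZle _ _ _); last 2 first.
- by rewrite invr_ge0.
- by move=> t; rewrite mule_ge0.
under [leRHS]eq_esum => t _ do rewrite muleA -EFinM mulVf// mul1e.
exact: lexx.
Qed.

Let esumZr (B : set nat) (w : nat -> R) (C : \bar R) :
  (forall i, 0 <= w i)%R -> 0 <= C ->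
  \esum_(i in B) ((w i)%:E * C) = (\esum_(i in B) (w i)%:E) * C.
Proof.
move=> w0; case: C => [r|_|//].
  rewrite lee_fin => r0; rewrite muleC -esumZl//.
  by apply: eq_esum => i _; rewrite muleC.
have [[i [Bi wi]]|no] := pselect (exists i, B i /\ w i != 0%R).
  have wp : 0 < (w i)%:E by rewrite lte_fin lt_neqAle eq_sym wi w0.
  have le1 (f : nat -> \bar R) : (forall j, 0 <= f j) ->
      f i <= \esum_(j in B) f j.
    move=> f0; rewrite -[leLHS](esum_set1 (a := f))//.
    by rewrite (esumID [set i] B)// setIC (setIidl _) ?leeDl ?esum_ge0// => _ ->.
  rewrite gt0_muley; last by apply: lt_le_trans wp (le1 (fun i => (w i)%:E) _).
  apply/eqP; rewrite eq_le leey /=.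
  apply: le_trans (le1 (fun i => (w i)%:E * +oo) _); first by rewrite gt0_muley.
  by move=> j; rewrite mule_ge0// lee_fin.
have w00 i : B i -> w i = 0%R.
  by move=> Bi; apply/eqP; apply: contrapT => /negP wi; apply: no; exists i.
rewrite !esum1 ?mul0e// => i Bi; first by rewrite w00.
by rewrite w00// mul0e.
Qed.

Lemma mu_pow_rect (b : nat -> R) (m : nat) (B : nat -> set nat) :
  mu_pow b [set t : m.-tuple nat | forall k : 'I_m, B k (tnth t k)]
  = \prod_(k < m) mu_b b (B k).
Proof.
elim: m B => [|m IH] B.
  rewrite big_ord0 /mu_pow (_ : [set _ | _] = [set [tuple]]).
    by rewrite esum_set1 big_nil// lee_fin.
  by apply/seteqP; split=> [t _|t _ []//] /=; rewrite tuple0.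
rewrite big_ord_recl /= -(IH (fun k => B k.+1)) /mu_pow /mu_b.
set A := [set _ | _]; set A' := [set t : m.-tuple nat | _].
have prodD0 (t : seq nat) : (0 <= \prod_(i <- t) b i ^+ 2)%R.
  by apply: prodr_ge0 => i _; exact: sqr_ge0.
rewrite -esumZr//; [|by move=> i; exact: sqr_ge0|by apply: esum_ge0 => t _; rewrite lee_fin].
rewrite [RHS](_ : _ = \esum_(i in B 0%N) \esum_(t in A')
    ((b i ^+ 2)%:E * (\prod_(j <- t) b j ^+ 2)%:E)); last first.
  apply: eq_esum => i _; rewrite esumZl ?sqr_ge0// => t.
  by rewrite lee_fin.
rewrite (esum_esum (J := fun=> A')); last first.
  by move=> i t _ _; rewrite mule_ge0 ?lee_fin ?sqr_ge0.
rewrite (@reindex_esum _ _ _ (B 0%N `*`` (fun=> A')) A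
  (fun p : nat * m.-tuple nat => [tuple of p.1 :: p.2])).
  by apply: eq_esum => -[i t] _ /=; rewrite big_cons.
split.
- move=> [i t] [/= Bi At] k; case: (unliftP ord0 k) => [j|] ->.
    by rewrite tnthS; exact: At.
  by rewrite tnth0.
- by move=> [i t] [i' t'] _ _ /= /(congr1 val) /= [-> /val_inj ->].
- move=> t At; exists (thead t, [tuple of behead t]); last by rewrite -tuple_eta.
  split=> /=; first by have := At ord0.
  by move=> k; have := At (lift ord0 k); rewrite {1}(tuple_eta t) tnthS.
Qed.

End mu_pow_rect.

Section index_sets.
Variable q : nat.
Implicit Types F : set (q.-tuple nat).

Definition Delta : set (q.-tuple nat) := [set t | uniq t].

(* Symmetry is what makes q! mu(F) the right normalization: the chaos sum over F
   has variance q! mu(F) exactly when, up to points of mass 0, F is symmetric. *)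
Definition symmetric_set F : Prop :=
  forall s t : q.-tuple nat, perm_eq s t -> F s -> F t.

Definition Fstar F (j : nat) : set (q.-tuple nat) :=
  [set t | F t /\ j \in tval t].

(* k does not coincide with i or j is meant up to the order of the entries:
   for a symmetric F, a nontrivial rearrangement k of i would otherwise put
   every disjoint pair (i, j) of F x F into Fsharp. *)
Definition Fsharp F : set (q.-tuple nat * q.-tuple nat) :=
  [set ij | [/\ F ij.1, F ij.2,
    (forall x, x \in tval ij.1 -> x \notin tval ij.2) &
    exists k l : q.-tuple nat, [/\ F k, F l,
      (tval k ++ tval l) =i (tval ij.1 ++ tval ij.2),
      ~~ perm_eq k ij.1 & ~~ perm_eq k ij.2]]].

Context {R : realType}.
Variable b : nat -> R.

Definition Phi F : R :=
  Num.sqrt (fine (mu_pow b [set [tuple of ij.1 ++ ij.2] | ij in Fsharp F]))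
  / fine (mu_pow b F).

Definition Psi F (j : nat) : R :=
  fine (mu_pow b (Fstar F j)) / fine (mu_pow b F).

End index_sets.
Arguments Delta : clear implicits.

Section random_variables.
Context {R : realType} {d : measure_display} {T : measurableType d}
  {P : probability T R}.

Definition mutually_independent (X : nat -> {RV P >-> R}) : Prop :=
  forall (J : seq nat) (B : nat -> set R), uniq J ->
    (forall i, measurable (B i)) ->
    P (\bigcap_(i in [set` J]) (X i @^-1` B i)) =
    (\prod_(i <- J) P (X i @^-1` B i))%E.

Definition rademacher_sequence (X : nat -> {RV P >-> R}) : Prop :=
  mutually_independent X /\
  forall i, P (X i @^-1` [set 1]) = (2^-1)%:E /\
            P (X i @^-1` [set -1]) = (2^-1)%:E.

Definition chaos_partial_sum (X : nat -> {RV P >-> R}) (b : nat -> R) (q : nat)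
    (F : set (q.-tuple nat)) (A : {fset q.-tuple nat}) (w : T) : R :=
  (Num.sqrt (q`!%:R * fine (mu_pow b F)))^-1 *
  \sum_(t <- A | t \in F) (\prod_(i <- t) b i) * (\prod_(i <- t) X i w).

(* For infinite F the sum is the L^2(P)-limit of its finite partial sums, along
   the net of all finite sets of indices; this determines S almost surely. *)
Definition is_chaos_sum (X : nat -> {RV P >-> R}) (b : nat -> R) (q : nat)
    (F : set (q.-tuple nat)) (S : {RV P >-> R}) : Prop :=
  ('E_P[(fun w => (S w - chaos_partial_sum X b F A w) ^+ 2)%R])%E
    @[A --> @summability.totally _] --> 0%E.

Definition standard_gaussian (N : {RV P >-> R}) : Prop :=
  forall B : set R, measurable B -> distribution P N B = normal_prob 0 1 B.

End random_variables.

Definition kolmogorov_distance {R : realType}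
    {d d' : measure_display} {T : measurableType d} {T' : measurableType d'}
    {P : probability T R} {P' : probability T' R}
    (S : {RV P >-> R}) (N : {RV P' >-> R}) : R :=
  sup (range (fun x : R => `|fine (cdf S x) - fine (cdf N x)|)).

(* Main.v *)
Require Import Defs.
From HB Require Import structures.
From mathcomp Require Import all_boot all_order all_algebra.
From mathcomp Require Import finmap.
From mathcomp Require Import all_classical all_reals all_analysis.
From mathcomp Require Import measurable_realfun.
From mathcomp Require Import ring lra.
Set Implicit Arguments.
Unset Strict Implicit.
Unset Printing Implicit Defensive.
Import Order.TTheory GRing.Theory Num.Theory.
Import numFieldNormedType.Exports.
Local Open Scope classical_set_scope.
Local Open Scope ring_scope.

(* The proof is Stein's method on a finite discrete cube.  The chaos sum is an
   L^2-limit of finite sums p = sum_I a_I chi_I over sets I of size q, with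
   Walsh functions chi_I on {-1, 1}^n.  Let y_k be the part of p that changes
   sign with the k-th coordinate.  Since sum_k y_k = q p, a second order Taylor
   expansion gives, up to 8/e E|y_k|^3 for each k when G' is (4/e)-Lipschitz,
   q E[p G(p)] = E[Gamma G'(p)] with Gamma = sum_k y_k^2.  Averaging the Stein
   solution of a half-line indicator over a window of length e gives such a G
   with |G'| <= 2, at the price of an error of order e.
   - The variance of Gamma is controlled by quadruples (I, J, K, L) with
     I \ J = K \ L and J \ I = L \ K.  If I and L are disjoint then (I, L) is a
     pair of F^sharp; otherwise some index lies in both, and the sum is at most
     the sum of the squared influences Psi_j^2.
   - By hypercontractivity E y_k^4 <= 9^q Psi_k^2, which bounds sum_k E|y_k|^3
     by the square root of sup Psi.
   The choice e = (sup Psi)^(1/4) balances the smoothing error with the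
   remainder. *)

(** * Stein's equation for the half-line indicators *)

Section calculus.
Context {R : realType}.
Implicit Types f g df : R -> R.

Lemma is_derive1_continuous f (x l : R) :
  is_derive x 1 f l -> {for x, continuous f}.
Proof.
move=> fl; apply: differentiable_continuous.
by apply/derivable1_diffP; exact: ex_derive.
Qed.

Lemma increment_bounds f df (a b lo hi : R) : a <= b ->
  (forall x, a < x < b -> is_derive x 1 f (df x)) ->
  (forall x, a <= x <= b -> {for x, continuous f}) ->
  (forall x, a < x < b -> lo <= df x <= hi) ->
  lo * (b - a) <= f b - f a <= hi * (b - a).
Proof.
rewrite le_eqVlt => /predU1P[->|ab] dfE cf dfb.
  by rewrite !subrr !mulr0 lexx.
have dfE' x : x \in `]a, b[ -> is_derive x 1 f (df x).
  by rewrite in_itv; exact: dfE.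
have cfab : {within `[a, b], continuous f}.
  by apply: continuous_in_subspaceT => x; rewrite inE/= in_itv/=; exact: cf.
have [x] := MVT ab dfE' cfab.
rewrite in_itv/= => /dfb /andP[lo_x x_hi] ->.
by rewrite !ler_pM2r ?subr_gt0// lo_x.
Qed.

(** The Stein solution of a half-line has a kink at [z]. Continuity there allows the mean value
    theorem on each side, and the two bounds add up. *)
Lemma increment_bounds_except f df (z a b lo hi : R) : a <= b ->
  (forall x, a < x < b -> x != z -> is_derive x 1 f (df x)) ->
  (forall x, a <= x <= b -> {for x, continuous f}) ->
  (forall x, a < x < b -> x != z -> lo <= df x <= hi) ->
  lo * (b - a) <= f b - f a <= hi * (b - a).
Proof.
move=> ab dfE cf dfb.
have [/andP[az zb]|zab] := boolP (a < z < b); last first.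
  apply: (@increment_bounds _ df) => // x xab; [apply: dfE|apply: dfb] => //;
    by apply: contraNneq zab => <-.
have /andP[lo1 hi1] : lo * (z - a) <= f z - f a <= hi * (z - a).
  apply: (@increment_bounds _ df); first exact: ltW.
  - by move=> x /andP[ax xz]; apply: dfE; lra.
  - by move=> x /andP[ax xz]; apply: cf; lra.
  - by move=> x /andP[ax xz]; apply: dfb; lra.
have /andP[lo2 hi2] : lo * (b - z) <= f b - f z <= hi * (b - z).
  apply: (@increment_bounds _ df); first exact: ltW.
  - by move=> x /andP[ax xz]; apply: dfE; lra.
  - by move=> x /andP[ax xz]; apply: cf; lra.
  - by move=> x /andP[ax xz]; apply: dfb; lra.
by apply/andP; split; lra.
Qed.

Lemma mean_value f df (a b : R) : a <= b ->
  (forall x, a <= x <= b -> is_derive x 1 f (df x)) ->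
  exists2 x, a <= x <= b & f b - f a = df x * (b - a).
Proof.
move=> ab dfE; have dfE' x : x \in `]a, b[ -> is_derive x 1 f (df x).
  by rewrite in_itv/= => /andP[ax xb]; apply: dfE; lra.
have cfab : {within `[a, b], continuous f}.
  apply: continuous_in_subspaceT => x; rewrite inE/= in_itv/= => /dfE.
  exact: is_derive1_continuous.
have [x] := MVT_segment ab dfE' cfab.
by rewrite in_itv; exists x.
Qed.

Lemma mean_value_norm f df (A u w : R) : A < u -> A < w ->
  (forall x, A < x -> is_derive x 1 f (df x)) ->
  exists x, [/\ A < x, `|x - w| <= `|u - w| & f u - f w = df x * (u - w)].
Proof.
move=> Au Aw dfE; have [wu|/ltW uw] := leP w u.
  have [x xin fE] : exists2 x, w <= x <= u & f u - f w = df x * (u - w).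
    by apply: mean_value => // x /andP[wx _]; apply: dfE; lra.
  by exists x; split=> //; [lra|rewrite !ger0_norm; lra].
have [x xin fE] : exists2 x, u <= x <= w & f w - f u = df x * (w - u).
  by apply: mean_value => // x /andP[wx _]; apply: dfE; lra.
by exists x; split=> //; [lra|rewrite !ler0_norm; lra|lra].
Qed.

(** The primitive is an integral from [a], hence the restriction to [a < x]. The finitely many
    values of a polynomial on the cube have a common lower bound, which will serve as [a]. *)
Lemma continuous_primitive f (a : R) : continuous f ->
  exists F : R -> R, forall x, a < x -> is_derive x 1 F (f x).
Proof.
move=> cf; exists (fun x => \int[lebesgue_measure]_(t in `[a, x]) f t)%R.
move=> x ax.
have [||dF FE] := @continuous_FTC1_closed R f a x (x + 1) _ _ ax (cf x).
- by rewrite ltrDl.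
- apply: continuous_compact_integrable; first exact: segment_compact.
  exact: continuous_subspaceT.
- by apply: DeriveDef; [exact: dF|rewrite -derive1E].
Qed.

End calculus.

(* The distribution function and the density, through the only properties that
   the estimates use: they are stable under the reflection of the line, so that
   right tails follow from left tails. *)
Definition standard_normal_pair {R : realType} (c phi : R -> R) : Prop :=
  [/\ forall x : R, is_derive x 1 c (phi x),
      forall x : R, is_derive x 1 phi (- x * phi x),
      forall x, 0 < phi x,
      (forall x, 0 <= c x <= 1) &
      (forall e w, 0 < e -> (exists2 u, u < w & c u < e) /\
                            (exists2 u, w < u & 1 - e < c u))].

(** * The Mills ratio of the normal tails *)

Section mills_ratio.
Context {R : realType} (c phi : R -> R) (cphi : standard_normal_pair c phi).

Let dc (x : R) : is_derive x 1 c (phi x). Proof. by case: cphi. Qed.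
Let dphi (x : R) : is_derive x 1 phi (- x * phi x). Proof. by case: cphi. Qed.
Let phi_gt0 x : 0 < phi x. Proof. by case: cphi. Qed.
Let phi_neq0 x : phi x != 0. Proof. by rewrite gt_eqF. Qed.
Let c01 x : 0 <= c x <= 1. Proof. by case: cphi. Qed.

Lemma normal_cdf_homo : {homo c : x y / x <= y}.
Proof.
move=> x y xy; have [t _ cE] := mean_value xy (fun t _ => dc t).
by rewrite -subr_ge0 cE mulr_ge0 ?subr_ge0// ltW.
Qed.

Lemma is_derive_mills (x : R) :
  is_derive x 1 (fun x => c x / phi x) (1 + x * (c x / phi x)).
Proof.
have dphiV := is_deriveV (phi_neq0 x) (dphi x).
apply: (is_derive_eq (is_deriveM (dc x) dphiV)).
by rewrite /GRing.scale /=; field.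
Qed.

(* On ]-oo, w], [phi + w c] has the nonnegative derivative [(w - x) phi x]. *)
Lemma mills_le w : w <= 0 -> - w * c w <= phi w.
Proof.
move=> w0; apply/ler_addgt0Pr => e e0.
(* At [u] the function [phi + w c] is at least [w * c u], and [c u < e / (1 - w)] keeps this above
   [- e]. *)
have [_ _ _ _ /(_ (e / (1 - w)) w)[|[u uw cu] _]] := cphi.
  by rewrite divr_gt0//; lra.
have dk (x : R) : u <= x <= w ->
    is_derive x 1 (fun x => phi x + w * c x) ((w - x) * phi x).
  move=> _; apply: (is_derive_eq (is_deriveD (dphi x) (is_deriveZ w (dc x)))).
  by rewrite /GRing.scale /=; ring.
have [x /andP[_ xw] kE] := mean_value (ltW uw) dk.
have : 0 <= (w - x) * phi x * (w - u).
  by rewrite !mulr_ge0 ?subr_ge0// ltW.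
rewrite -kE; have := phi_gt0 u; move: cu; rewrite ltr_pdivlMr; last by lra.
have /andP[] := c01 u; nra.
Qed.

Lemma mills_ratio_le w : w <= 0 -> - w * (c w / phi w) <= 1.
Proof. by move=> w0; rewrite mulrA ler_pdivrMr// mul1r mills_le. Qed.

(** By [mills_ratio_le] the derivative in [is_derive_mills] is nonnegative on the left half-line, so
    the ratio is largest at 0, where [c 0 <= 1]. *)
Lemma mills_ratio_bounded w : w <= 0 -> c w / phi w <= (phi 0)^-1.
Proof.
move=> w0.
have [x /andP[_ x0] mE] := mean_value w0 (fun x _ => is_derive_mills x).
have : c 0 / phi 0 <= (phi 0)^-1.
  have /andP[_ c1] := c01 0.
  by rewrite ler_piMl// invr_ge0 ltW.
apply: le_trans; rewrite -subr_ge0 mE mulr_ge0 ?subr_ge0//.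
by have := mills_ratio_le x0; lra.
Qed.

Lemma standard_normal_pairN :
  standard_normal_pair (fun x => 1 - c (- x)) (fun x => phi (- x)).
Proof.
split=> [x|x|x|x|e w e0].
- have dcN := is_derive1_comp (dc (- x)) (is_deriveN (is_derive_id x (1 : R))).
  apply: (is_derive_eq (is_deriveB (is_derive_cst (1 : R) x 1) dcN)).
  by rewrite /GRing.scale /=; ring.
- have dphiN :=
    is_derive1_comp (dphi (- x)) (is_deriveN (is_derive_id x (1 : R))).
  by apply: (is_derive_eq dphiN); rewrite /GRing.scale /=; ring.
- exact: phi_gt0.
- by have := c01 (- x); lra.
- have [_ _ _ _ /(_ e (- w) e0)[[u uw cu] [v wv cv]]] := cphi.
  split; [exists (- v)|exists (- u)]; rewrite ?opprK; lra.
Qed.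

End mills_ratio.

(** * The Stein solution, its derivative and its smoothing *)

Section stein_solution.
Context {R : realType} (c phi : R -> R) (cphi : standard_normal_pair c phi).

Let dc (x : R) : is_derive x 1 c (phi x). Proof. by case: cphi. Qed.
Let dphi (x : R) : is_derive x 1 phi (- x * phi x). Proof. by case: cphi. Qed.
Let phi_gt0 x : 0 < phi x. Proof. by case: cphi. Qed.
Let phi_neq0 x : phi x != 0. Proof. by rewrite gt_eqF. Qed.
Let c01 x : 0 <= c x <= 1. Proof. by case: cphi. Qed.

(** The bounded solution of Stein's equation [f' w - w * f w = (w <= z) - c z]; the minimum merges
    the two usual formulas on either side of [z]. *)
Definition stein_sol (z w : R) : R := (Num.min (c w) (c z) - c w * c z) / phi w.

Let le_min z w : 0 <= Num.min (c w) (c z) - c w * c z <= c w * (1 - c w).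
Proof.
have [/andP[cw0 cw1] /andP[cz0 cz1]] := (c01 w, c01 z).
by have [cwz|czw] := leP (c w) (c z); apply/andP; split; nra.
Qed.

(** For fixed [w] the numerator is largest when [c z = c w], where it equals [c w * (1 - c w)].
    Dropping one factor leaves the Mills ratio of the left tail if [w <= 0] and, by reflection, of
    the right tail otherwise. *)
Lemma stein_sol_bounds z w : 0 <= stein_sol z w <= (phi 0)^-1.
Proof.
have /andP[min0 min_le] := le_min z w.
rewrite /stein_sol divr_ge0 ?(ltW (phi_gt0 w))//=.
apply: (@le_trans _ _ (c w * (1 - c w) / phi w)).
  by rewrite ler_pM2r ?invr_gt0.
have [/andP[cw0 cw1]] := c01 w.
have [w0|/ltW w0] := leP w 0.
  apply: le_trans (mills_ratio_bounded cphi w0).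
  by rewrite ler_pM2r ?invr_gt0//; nra.
have := mills_ratio_bounded (standard_normal_pairN cphi) (_ : - w <= 0).
rewrite opprK oppr0 oppr_le0 => /(_ w0); apply: le_trans.
by rewrite ler_pM2r ?invr_gt0//; nra.
Qed.

Lemma mul_stein_sol_le1 z w : `|w * stein_sol z w| <= 1.
Proof.
have /andP[min0 min_le] := le_min z w.
have [/andP[cw0 cw1]] := c01 w.
have /andP[f0 _] := stein_sol_bounds z w; rewrite normrM (ger0_norm f0).
rewrite /stein_sol mulrA ler_pdivrMr// mul1r.
have [w0|/ltW w0] := leP w 0.
  apply: le_trans (mills_le cphi w0).
  by rewrite ler0_norm// ler_wpM2l ?oppr_ge0//; nra.
have := mills_le (standard_normal_pairN cphi) (_ : - w <= 0).
rewrite !opprK oppr_le0 => /(_ w0); apply: le_trans.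
by rewrite ger0_norm// ler_wpM2l//; nra.
Qed.

(** The derivative dictated by Stein's equation: the true one off [z], the left one at [z]. *)
Definition stein_deriv (z w : R) : R := w * stein_sol z w + (w <= z)%R%:R - c z.

Lemma stein_deriv_bounds z w : -2 <= stein_deriv z w <= 2.
Proof.
have := mul_stein_sol_le1 z w; rewrite ler_norml /stein_deriv => /andP[? ?].
by have := c01 z; case: (w <= z) => /= /andP[? ?]; apply/andP; split; lra.
Qed.

Lemma stein_sol_continuous z : continuous (stein_sol z).
Proof.
move=> w; have cw := is_derive1_continuous (dc w).
have cphiV : {for w, continuous (fun x => (phi x)^-1)}.
  by apply: continuousV => //; exact: is_derive1_continuous (dphi w).
have cst_c : {for w, continuous (fun=> c z : R)} by exact: cst_continuous.
exact: (continuousM (continuousB (continuous_min cw cst_c)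
  (continuousM cw cst_c)) cphiV).
Qed.

Lemma is_derive_stein_sol z (w : R) : w != z ->
  is_derive w 1 (stein_sol z) (stein_deriv z w).
Proof.
have dphiV := is_deriveV (phi_neq0 w) (dphi w).
have dmills := is_derive_mills cphi w.
rewrite neq_lt /stein_deriv => /orP[wz|zw].
- apply: (near_eq_is_derive (f := fun x => (1 - c z) * (c x / phi x))).
    near=> x; rewrite /stein_sol min_l; first by ring.
    by apply: (normal_cdf_homo cphi); apply/ltW; near: x; exact: lt_nbhsl.
  apply: (is_derive_eq (is_deriveZ (1 - c z) dmills)).
  rewrite /stein_sol min_l ?(ltW wz)//; last exact/(normal_cdf_homo cphi)/ltW.
  by rewrite /GRing.scale /=; ring.
- apply: (near_eq_is_derive
      (f := fun x => c z * ((phi x)^-1 - c x / phi x))).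
    near=> x; rewrite /stein_sol min_r; first by ring.
    by apply: (normal_cdf_homo cphi); apply/ltW; near: x; exact: lt_nbhsr.
  apply: (is_derive_eq (is_deriveZ (c z) (is_deriveB dphiV dmills))).
  rewrite /stein_sol min_r; last exact/(normal_cdf_homo cphi)/ltW.
  by rewrite leNgt zw /GRing.scale /=; field.
Unshelve. all: by end_near.
Qed.

Lemma stein_sol_lipschitz z u w :
  `|stein_sol z u - stein_sol z w| <= 2 * `|u - w|.
Proof.
wlog wu : u w / w <= u.
  move=> h; have [|/ltW] := leP w u; first exact: h.
  by rewrite distrC (distrC u); exact: h.
have := @increment_bounds_except _ _ _ z w u (-2) 2 wu
  (fun x _ xz => is_derive_stein_sol xz) (fun x _ => @stein_sol_continuous z x)
  (fun x _ _ => stein_deriv_bounds z x).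
by rewrite (ger0_norm (x := u - w)) ?subr_ge0// ler_norml mulNr.
Qed.

(* [G] is the average of the Stein solution over [w, w + e], which turns the
   jump of its derivative into a Lipschitz bound. *)
Lemma smoothed_stein_solution (z e A : R) : 0 < e ->
  exists G dG : R -> R, forall w, A < w ->
  [/\ forall u, A < u -> `|G u - G w - (u - w) * dG w| <= 4 / e * (u - w) ^+ 2,
      `|dG w| <= 2,
      (w <= z - e)%R%:R - c z <= dG w - w * G w &
      dG w - w * G w <= (w <= z)%R%:R - c z + e / phi 0].
Proof.
move=> e0; have [H dH] := continuous_primitive A (@stein_sol_continuous z).
pose f := stein_sol z.
(* Since [H] is a primitive of [f], the first witness is the window average and the second its
   derivative. The Lipschitz constant 2 of [f] controls both the size and the Lipschitz constant of
   the latter. *)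
exists (fun w => (H (w + e) - H w) / e), (fun w => (f (w + e) - f w) / e).
have lipf := stein_sol_lipschitz z.
have dG (x : R) : A < x ->
    is_derive x 1 (fun w => (H (w + e) - H w) / e) ((f (x + e) - f x) / e).
  move=> Ax; have Axe : A < x + e by lra.
  have dshift : is_derive x 1 (fun y : R => y + e) 1.
    apply: (is_derive_eq
      (is_deriveD (is_derive_id x (1 : R)) (is_derive_cst e x (1 : R)))).
    by rewrite addr0.
  have dHe := @is_derive1_comp _ H (fun y => y + e) x _ _ (dH _ Axe) dshift.
  have dHB := is_deriveB dHe (dH _ Ax).
  apply: (is_derive_eq (is_deriveM dHB (is_derive_cst e^-1 x (1 : R)))).
  by rewrite /GRing.scale /= /f; ring.
(* With [w] frozen, [K] has derivative [(x - w) * f x + (x <= z) - c z] off [z], and its difference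
   quotient over the window is exactly [dG w - w * G w]. The term [(x - w) * f x] accounts for the
   error [e / phi 0]. *)
move=> w Aw; pose K x := f x - w * H x.
have dK (x : R) : w < x < w + e -> x != z ->
    is_derive x 1 K ((x - w) * f x + (x <= z)%R%:R - c z).
  move=> /andP[wx _] xz; have Ax : A < x by lra.
  apply: (is_derive_eq
    (is_deriveB (is_derive_stein_sol xz) (is_deriveZ w (dH _ Ax)))).
  by rewrite /GRing.scale /= /stein_deriv /f; ring.
have cK (x : R) : w <= x <= w + e -> {for x, continuous K}.
  move=> /andP[wx _]; have Ax : A < x by lra.
  have cst_w : {for x, continuous (fun=> w : R)} by exact: cst_continuous.
  exact: (continuousB (@stein_sol_continuous z x)
    (continuousM cst_w (is_derive1_continuous (dH _ Ax)))).
have KE : (f (w + e) - f w) / e - w * ((H (w + e) - H w) / e) =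
    (K (w + e) - K w) / e by rewrite /K; field; rewrite gt_eqF.
have wwe : w <= w + e by lra.
have xf x : w < x < w + e -> 0 <= (x - w) * f x <= e / phi 0.
  move=> xw; have /andP[f0 fB] := stein_sol_bounds z x.
  by rewrite mulr_ge0 ?ler_pM//; lra.
split.
- move=> u Au; have [x [Ax xw ->]] := mean_value_norm Au Aw dG.
  rewrite (mulrC (u - w)) -mulrBl normrM.
  rewrite -(real_normK (num_real (u - w))) expr2 mulrA.
  rewrite ler_wpM2r//; apply: (@le_trans _ _ (4 / e * `|x - w|)); last first.
    by rewrite ler_wpM2l// divr_ge0// ltW.
  have -> : (f (x + e) - f x) / e - (f (w + e) - f w) / e =
    ((f (x + e) - f (w + e)) - (f x - f w)) / e by ring.
  rewrite normrM normfV (gtr0_norm e0) mulrAC ler_pM2r ?invr_gt0//.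
  apply: (le_trans (ler_normB _ _)).
  have := lipf (x + e) (w + e); have := lipf x w.
  have -> : x + e - (w + e) = x - w by ring.
  by rewrite -/f; lra.
- rewrite normrM normfV (gtr0_norm e0) ler_pdivrMr//.
  by have := lipf (w + e) w; rewrite addrAC subrr add0r (gtr0_norm e0).
(* If [w <= z - e] the window lies to the left of [z] up to its endpoint; if [w > z] it lies to the
   right. Hence the two thresholds [z - e] and [z]. *)
- rewrite KE ler_pdivlMr//.
  have := @increment_bounds_except _ K _ z w (w + e)
    ((w <= z - e)%R%:R - c z) (1 + e / phi 0) wwe dK cK.
  rewrite [_ + e - w]addrAC subrr add0r => incr.
  suff /incr/andP[] : forall x, w < x < w + e -> x != z ->
    (w <= z - e)%R%:R - c z <= (x - w) * f x + (x <= z)%R%:R - c z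
      <= 1 + e / phi 0 by [].
  move=> x xw _.
  have := xf _ xw; have /andP[cz0 cz1] := c01 z.
  have [wz|wz] := leP w (z - e); have [xz|xz] := leP x z => /=; lra.
- rewrite KE ler_pdivrMr//.
  have := @increment_bounds_except _ K _ z w (w + e)
    (- 1) ((w <= z)%R%:R - c z + e / phi 0) wwe dK cK.
  rewrite [_ + e - w]addrAC subrr add0r => incr.
  suff /incr/andP[] : forall x, w < x < w + e -> x != z ->
    - 1 <= (x - w) * f x + (x <= z)%R%:R - c z
      <= (w <= z)%R%:R - c z + e / phi 0 by [].
  move=> x xw _.
  have := xf _ xw; have /andP[cz0 cz1] := c01 z.
  have [wz|wz] := leP w z; have [xz|xz] := leP x z => /=; lra.
Qed.


End stein_solution.

(** * The standard normal distribution function *)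

Section normal_cdf.
Context {R : realType}.

Let phi : R -> R := normal_pdf 0 1.
Let c (x : R) : R := fine (normal_prob 0 1 `]-oo, x]).

Let is_derive_normal_pdf (x : R) : is_derive x 1 phi (- x * phi x).
Proof.
have -> : phi = (fun y => normal_peak 1 * expR (- (2^-1 * (y * y)))).
  apply/funext => y; rewrite /phi normal_pdfE ?oner_eq0// /normal_fun subr0.
  by congr (_ * expR _); rewrite expr1n expr2; lra.
have dsq : is_derive x 1 (fun y : R => - (2^-1 * (y * y))) (- x).
  have d2 := is_deriveM (is_derive_id x (1 : R)) (is_derive_id x (1 : R)).
  apply: (is_derive_eq (is_deriveN (is_deriveZ (2^-1 : R) d2))).
  by rewrite /GRing.scale /=; lra.
have dE := is_deriveZ (normal_peak (1 : R))
  (is_derive1_comp (is_derive_expR _) dsq).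
apply: (is_derive_eq dE).
by rewrite /GRing.scale /=; ring.
Qed.

Let is_derive_normal_cdf (x : R) : is_derive x 1 c (phi x).
Proof.
have intphi y : lebesgue_measure.-integrable `]-oo, y] (EFin \o phi).
  by apply: (integrableS _ _ (@subsetT _ _) (integrable_normal_pdf 0 1)).
have xx1 : x < x + 1 by rewrite ltrDl.
have cphi : {for x, continuous phi}.
  by apply: continuous_normal_pdf; exact: oner_neq0.
have [dc cE] := continuous_FTC1 xx1 (intphi _) (ltNyr x) cphi.
by apply: DeriveDef; [exact: dc|rewrite -derive1E].
Qed.

Lemma standard_normal_pair_cdf d (T : measurableType d) (P : probability T R)
    (N : {RV P >-> R}) : standard_gaussian N ->
  standard_normal_pair (fun x => fine (cdf N x)) (normal_pdf 0 1).
Proof.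
move=> gN; have cE : (fun x => fine (cdf N x)) = c.
  by apply/funext => x; rewrite /cdf gN.
split.
- by move=> x; rewrite cE; exact: is_derive_normal_cdf.
- exact: is_derive_normal_pdf.
- move=> x; rewrite normal_pdfE ?oner_eq0// mulr_gt0 ?expR_gt0//.
  by rewrite normal_peak_gt0 ?oner_eq0.
- by move=> x; rewrite -!lee_fin fineK ?fin_num_measure// cdf_ge0 cdf_le1.
- move=> e w e0; split.
    have /fine_cvg/cvgr_lt/(_ e e0) cN0 := cvg_cdfNy0 N.
    near (-oo%R : set_system R) => u; exists u; near: u => //.
    by apply: nbhs_ninfty_lt; exact: num_real.
  have /fine_cvg/cvgr_gt/(_ (1 - e)) cN1 := cvg_cdfy1 N.
  have e1 : 1 - e < 1 by lra.
  near (+oo%R : set_system R) => u; exists u; near: u; last exact: cN1.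
  by apply: nbhs_pinfty_gt; exact: num_real.
Unshelve. all: by end_near.
Qed.

Lemma normal_cdf_increment d (T : measurableType d) (P : probability T R)
    (N : {RV P >-> R}) : standard_gaussian N -> forall x y, x <= y ->
  fine (cdf N y) <= fine (cdf N x) + normal_peak 1 * (y - x).
Proof.
move=> /standard_normal_pair_cdf[dN _ _ _ _] x y xy.
have [t _ cE] := mean_value xy (fun t _ => dN t).
by rewrite -lerBlDl cE ler_wpM2r ?subr_ge0// normal_pdf_ub// oner_neq0.
Qed.

End normal_cdf.

(** * Walsh polynomials on the discrete cube *)

Section finite_sums.
Context {R : realType}.

(** Cauchy-Schwarz by Lagrange's identity, which writes the difference of the two sides as half a
    sum of squares. *)
Lemma sum_mul_sqr_le (T : finType) (P : pred T) (f g : T -> R) :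
  (\sum_(i | P i) f i * g i) ^+ 2 <=
  (\sum_(i | P i) f i ^+ 2) * (\sum_(i | P i) g i ^+ 2).
Proof.
have : 0 <= \sum_(i | P i) \sum_(j | P j) (f i * g j - f j * g i) ^+ 2.
  by apply: sumr_ge0 => i _; apply: sumr_ge0 => j _; exact: sqr_ge0.
set A := \sum_(i | P i) f i ^+ 2; set B := \sum_(i | P i) g i ^+ 2.
set C := \sum_(i | P i) f i * g i.
have -> : \sum_(i | P i) \sum_(j | P j) (f i * g j - f j * g i) ^+ 2 =
    2 * (A * B - C ^+ 2).
  transitivity (\sum_(i | P i)
      (f i ^+ 2 * B + g i ^+ 2 * A - 2 * (f i * g i) * C)).
    apply: eq_bigr => i _; rewrite !mulr_sumr -sumrN -!big_split /=.
    by apply: eq_bigr => j _; ring.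
  rewrite !big_split /= -!mulr_suml sumrN -!mulr_suml -mulr_sumr -/A -/B -/C.
  by ring.
by lra.
Qed.

Lemma sqr_sum_le_card (T : finType) (P : pred T) (f : T -> R) :
  (\sum_(i | P i) f i) ^+ 2 <= #|P|%:R * \sum_(i | P i) f i ^+ 2.
Proof.
have := sum_mul_sqr_le P (fun=> 1) f.
under eq_bigr do rewrite mul1r.
under [X in _ <= X * _]eq_bigr do rewrite expr1n.
by rewrite sumr_const.
Qed.

End finite_sums.

Section cube.
Import mathcomp.boot.fintype mathcomp.boot.finset.
Local Close Scope classical_set_scope.
Context {R : realType} {V : finType}.
Implicit Types (w I J K L Z : {set V}) (f g : {set V} -> R) (k : V).

(* A point of the cube {-1, 1}^V is encoded by the set of its negative
   coordinates. *)
Definition chi I w : R := \prod_(i in I) (-1) ^+ (i \in w).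

Definition flip k w : {set V} := [set x | (x \in w) (+) (x == k)].

Definition cube_mean f : R := (2 ^+ #|V|)^-1 * \sum_w f w.

Definition cube_poly f w : R := \sum_I f I * chi I w.

Lemma flipK k : involutive (flip k).
Proof. by move=> w; apply/setP => x; rewrite !inE -addbA addbb addbF. Qed.

Lemma chi_flip k I w : chi I (flip k w) = (-1) ^+ (k \in I) * chi I w.
Proof.
rewrite /chi; have [kI|kI] := boolP (k \in I).
  rewrite !(big_setD1 k kI) /= !inE eqxx signr_addb.
  rewrite (mulrC (_ ^+ (k \in w))) -mulrA.
  congr (_ * (_ * _)).
  apply: eq_bigr => i; rewrite !inE => /andP[/negbTE -> _].
  by rewrite addbF.
rewrite mul1r; apply: eq_bigr => i iI; rewrite !inE.
by rewrite (_ : i == k = false) ?addbF//; apply: contraNF kI => /eqP <-.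
Qed.

Lemma chi_sqr I w : chi I w * chi I w = 1.
Proof.
rewrite -big_split /=; apply: big1 => i _.
by rewrite -signr_addb addbb.
Qed.

Lemma chi_mul I J w : chi I w * chi J w = chi ((I :\: J) :|: (J :\: I)) w.
Proof.
have chiU : chi ((I :\: J) :|: (J :\: I)) w = chi (I :\: J) w * chi (J :\: I) w.
  rewrite /chi -bigU; last first.
    by apply/pred0P => x /=; rewrite !inE; case: (x \in I); case: (x \in J).
  by apply: eq_bigl => i; rewrite !inE.
have chiE A B : chi A w = chi (A :&: B) w * chi (A :\: B) w.
  exact: big_setID.
by rewrite chiU (chiE I J) (chiE J I) (setIC J) mulrACA chi_sqr mul1r.
Qed.

Lemma cube_mean_flip k f : cube_mean (f \o flip k) = cube_mean f.
Proof.
congr (_ * _); rewrite [RHS](reindex_inj (inv_inj (flipK k))).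
exact: eq_bigr.
Qed.

Lemma eq_cube_mean f g : f =1 g -> cube_mean f = cube_mean g.
Proof. by move=> fg; congr (_ * _); exact: eq_bigr. Qed.

Lemma cube_meanD f g :
  cube_mean (fun w => f w + g w) = cube_mean f + cube_mean g.
Proof. by rewrite /cube_mean big_split mulrDr. Qed.

Lemma cube_meanZ (c : R) f : cube_mean (fun w => c * f w) = c * cube_mean f.
Proof. by rewrite /cube_mean -mulr_sumr mulrCA. Qed.

Lemma cube_meanN f : cube_mean (fun w => - f w) = - cube_mean f.
Proof. by rewrite /cube_mean sumrN mulrN. Qed.

Lemma cube_meanB f g :
  cube_mean (fun w => f w - g w) = cube_mean f - cube_mean g.
Proof. by rewrite cube_meanD cube_meanN. Qed.

Lemma cube_mean_sum (T : finType) (P : pred T) (F : T -> {set V} -> R) :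
  cube_mean (fun w => \sum_(i | P i) F i w) = \sum_(i | P i) cube_mean (F i).
Proof. by rewrite /cube_mean exchange_big /= mulr_sumr. Qed.

Lemma cube_mean_cst (c : R) : cube_mean (fun=> c) = c.
Proof.
rewrite /cube_mean sumr_const (_ : #|_| = 2 ^ #|V|)%N.
  by rewrite -(mulr_natl c) natrX mulKf// expf_neq0// pnatr_eq0.
by rewrite -[in RHS]cardsT -card_powerset powersetT cardsT.
Qed.

Lemma le_cube_mean f g : (forall w, f w <= g w) -> cube_mean f <= cube_mean g.
Proof.
move=> fg; rewrite ler_wpM2l ?invr_ge0 ?exprn_ge0//.
by apply: ler_sum => w _.
Qed.

(** Flipping a coordinate that lies in exactly one of [I] and [J] preserves the mean but negates the
    product, whence the orthonormality of the Walsh functions. *)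
Lemma cube_mean_chi_mul I J :
  cube_mean (fun w => chi I w * chi J w) = (I == J)%:R.
Proof.
have [<-|neqIJ] := eqVneq I J.
  by rewrite (eq_cube_mean (chi_sqr I)) cube_mean_cst.
have [k kIJ] : exists k, (k \in I) != (k \in J).
  apply/existsP; rewrite -negb_forall; apply: contra neqIJ => /forallP IJ.
  by apply/eqP/setP => k; apply/eqP.
set f := fun w => _; have : cube_mean f = - cube_mean f.
  rewrite -cube_meanN -(cube_mean_flip k f); apply: eq_cube_mean => w /=.
  rewrite /f !chi_flip mulrACA -signr_addb.
  have -> : (k \in I) (+) (k \in J) = true.
    by move: kIJ; case: (k \in I); case: (k \in J).
  by rewrite mulN1r.
by rewrite mulr0n; move: (cube_mean f) => x; lra.
Qed.

Lemma cube_poly_mean_sqr (a : {set V} -> R) :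
  cube_mean (fun w => cube_poly a w ^+ 2) = \sum_I a I ^+ 2.
Proof.
transitivity (cube_mean (fun w =>
    \sum_I \sum_J a I * a J * (chi I w * chi J w))).
  apply: eq_cube_mean => w; rewrite expr2 /cube_poly big_distrl /=.
  apply: eq_bigr => I _; rewrite big_distrr /=; apply: eq_bigr => J _.
  exact: mulrACA.
rewrite cube_mean_sum; apply: eq_bigr => I _.
rewrite cube_mean_sum (bigD1 I)//= big1.
  by rewrite addr0 cube_meanZ cube_mean_chi_mul eqxx mulr1.
by move=> J /negbTE JI; rewrite cube_meanZ cube_mean_chi_mul eq_sym JI mulr0.
Qed.

Lemma cube_mean_mul_sqr_le f g :
  cube_mean (fun w => f w * g w) ^+ 2 <=
  cube_mean (fun w => f w ^+ 2) * cube_mean (fun w => g w ^+ 2).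
Proof.
rewrite /cube_mean; set c := (2 ^+ _)^-1.
have c0 : 0 <= c ^+ 2 by exact: sqr_ge0.
by have := ler_wpM2l c0 (sum_mul_sqr_le xpredT f g); lra.
Qed.

(* The part of the polynomial that changes sign under [flip k]. *)
Definition part k (a : {set V} -> R) I : R := if k \in I then a I else 0.

Lemma cube_poly_part_flip k (a : {set V} -> R) w :
  cube_poly (part k a) (flip k w) = - cube_poly (part k a) w.
Proof.
rewrite /cube_poly -sumrN; apply: eq_bigr => I _; rewrite chi_flip /part.
by case: (k \in I); rewrite ?mul0r ?oppr0// mulN1r mulrN.
Qed.

Lemma cube_poly_flip k (a : {set V} -> R) w :
  cube_poly a (flip k w) = cube_poly a w - 2 * cube_poly (part k a) w.
Proof.
rewrite /cube_poly mulr_sumr -sumrB; apply: eq_bigr => I _.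
rewrite chi_flip /part.
by case: (k \in I); rewrite ?mulN1r ?mul1r; ring.
Qed.

(** The arithmetic of Bonami's induction for a polynomial [s + x_k r]: [S4], [R4] and [X] are the
    means of [s^4], [r^4] and [s^2 r^2], while [A] and [B] are the sums of squared coefficients.
    Cauchy-Schwarz gives [6 * X <= 18 * c * A * B], the cross term of the square. *)
Lemma bonami_step (m S4 R4 X A B c : R) :
  0 <= A -> 0 <= B -> 0 <= c -> 0 <= X ->
  X ^+ 2 <= S4 * R4 -> 0 <= S4 -> 0 <= R4 ->
  S4 <= 9 * c * A ^+ 2 -> R4 <= c * B ^+ 2 ->
  m = S4 + 6 * X + R4 -> m <= 9 * c * (A + B) ^+ 2.
Proof.
move=> A0 B0 c0 X0 XSR S40 R40 S4A R4B ->.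
have : X <= 3 * c * A * B.
  rewrite -ler_sqr ?nnegrE ?mulr_ge0//; apply: (le_trans XSR).
  have -> : (3 * c * A * B) ^+ 2 = (9 * c * A ^+ 2) * (c * B ^+ 2) by ring.
  by rewrite ler_pM.
have : 0 <= c * B ^+ 2 by rewrite mulr_ge0// sqr_ge0.
by nra.
Qed.

Lemma cube_poly_split k (a : {set V} -> R) w :
  cube_poly a w =
    cube_poly (fun I => if k \in I then 0 else a I) w + cube_poly (part k a) w.
Proof.
rewrite /cube_poly -big_split /=; apply: eq_bigr => I _; rewrite /part -mulrDl.
by case: (k \in I); rewrite ?add0r ?addr0.
Qed.

(** Factoring out the [k]-th sign removes the variable [k] and lowers the degree by one, as the
    induction of [bonami_lemma] requires. *)
Lemma cube_poly_part k (a : {set V} -> R) w :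
  cube_poly (part k a) w = (-1) ^+ (k \in w) *
    cube_poly (fun J => if k \in J then 0 else a (k |: J)) w.
Proof.
rewrite /cube_poly mulr_sumr (bigID (fun I => k \in I)) /= addrC big1 ?add0r.
  rewrite [RHS](bigID (fun I => k \in I)) /=.
  rewrite [X in _ = X + _]big1 ?add0r; last first.
    by move=> J ->; rewrite mul0r mulr0.
  rewrite (reindex_onto (fun J => k |: J) (fun I => I :\ k)) /=; last first.
    by move=> I kI; rewrite setD1K.
  apply: eq_big => [J|J].
    rewrite setU11 /=; apply/eqP/idP => [<-|kJ]; first by rewrite setD11.
    by rewrite setU1K.
  move=> /andP[_ /eqP <-]; rewrite setD1K ?setU11// setD11 /part setU11.
  by rewrite /chi (big_setD1 k) ?setU11//= mulrCA.
by move=> I /negbTE kI; rewrite /part kI mul0r.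
Qed.

Lemma cube_poly_mean_4_const (a : {set V} -> R) d :
  (forall I, a I != 0 -> I = set0) ->
  cube_mean (fun w => cube_poly a w ^+ 4) <= 9 ^+ d * (\sum_I a I ^+ 2) ^+ 2.
Proof.
move=> a0; have a_eq0 I : I != set0 -> a I = 0.
  by apply: contraNeq => /a0 ->.
have -> : \sum_I a I ^+ 2 = a set0 ^+ 2.
  rewrite (bigD1 set0)//= big1 ?addr0// => I /a_eq0 ->.
  by rewrite expr0n.
have pE w : cube_poly a w ^+ 4 = (a set0 ^+ 2) ^+ 2.
  rewrite /cube_poly (bigD1 set0)//= big1 ?addr0.
    by rewrite /chi big_set0 mulr1 -exprM.
  by move=> I /a_eq0 ->; rewrite mul0r.
rewrite (eq_cube_mean pE) cube_mean_cst ler_peMl ?sqr_ge0//.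
by rewrite exprn_ege1// ler1n.
Qed.

(** Induction on a bound for the number of variables. Removing [k] splits the polynomial into [aS],
    of the same degree bound, and [k]-th sign times [aR], of degree bound one less; the factor 9 is
    paid when the degree goes up. *)
Lemma bonami_lemma n : forall d (D : {set V}) (a : {set V} -> R),
  (#|D| <= n)%N -> (forall I, a I != 0 -> I \subset D /\ (#|I| <= d)%N) ->
  cube_mean (fun w => cube_poly a w ^+ 4) <= 9 ^+ d * (\sum_I a I ^+ 2) ^+ 2.
Proof.
elim: n => [|n IHn] [|d] D a Dn aD.
- apply: cube_poly_mean_4_const => I /aD[_].
  by rewrite leqn0 cards_eq0 => /eqP.
- apply: cube_poly_mean_4_const => I /aD[ID _]; apply/eqP.
  by move: Dn; rewrite -subset0 leqn0 cards_eq0 => /eqP <-.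
- apply: cube_poly_mean_4_const => I /aD[_].
  by rewrite leqn0 cards_eq0 => /eqP.
have [D0|[k kD]] := set_0Vmem D.
  by apply: (IHn d.+1 D) => //; rewrite D0 cards0.
have Dkn : (#|D :\ k| <= n)%N by move: Dn; rewrite (cardsD1 k) kD.
pose aS I := if k \in I then 0 else a I.
pose aR J := if k \in J then 0 else a (k |: J).
have sD I : aS I != 0 -> I \subset D :\ k /\ (#|I| <= d.+1)%N.
  rewrite /aS; case: ifP => [|kI /aD[ID ->]]; first by rewrite eqxx.
  by rewrite subsetD1 ID kI.
have rD J : aR J != 0 -> J \subset D :\ k /\ (#|J| <= d)%N.
  rewrite /aR; case: ifP => [|kJ /aD[]]; first by rewrite eqxx.
  rewrite subUset => /andP[_ JD]; rewrite cardsU1 kJ add1n ltnS => ->.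
  by rewrite subsetD1 JD kJ.
have IHS := IHn d.+1 (D :\ k) aS Dkn sD.
have IHR := IHn d (D :\ k) aR Dkn rD.
(* Averaging over the [k]-th sign cancels the odd powers of the part at [k]; used with [h] the
   square and the fourth power. *)
have flip_mean (h : R -> R) : cube_mean (fun w => h (cube_poly a w)) =
    cube_mean (fun w => 2^-1 * (h (cube_poly aS w + cube_poly (part k a) w) +
                                h (cube_poly aS w - cube_poly (part k a) w))).
  rewrite cube_meanZ cube_meanD -[X in _ + X](cube_mean_flip k).
  have -> : cube_mean (fun w => h (cube_poly aS w + cube_poly (part k a) w)) =
      cube_mean (fun w => h (cube_poly a w)).
    by apply: eq_cube_mean => w; rewrite (cube_poly_split k a).
  have -> : cube_mean ((fun w => h (cube_poly aS w - cube_poly (part k a) w))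
      \o flip k) = cube_mean (fun w => h (cube_poly a w)).
    apply: eq_cube_mean => w /=; rewrite cube_poly_part_flip opprK.
    congr h; rewrite (cube_poly_split k a); congr (_ + _).
    apply: eq_bigr => I _; rewrite /aS chi_flip.
    by case: (k \in I); rewrite ?mul0r// mul1r.
  by lra.
have yr w : cube_poly (part k a) w ^+ 2 = cube_poly aR w ^+ 2.
  by rewrite cube_poly_part exprMn -exprM mulnC exprM sqrrN expr1n expr1n mul1r.
have -> : \sum_I a I ^+ 2 = \sum_I aS I ^+ 2 + \sum_I aR I ^+ 2.
  rewrite -!cube_poly_mean_sqr (flip_mean (fun x => x ^+ 2)) -cube_meanD.
  by apply: eq_cube_mean => w; rewrite -yr; lra.
rewrite exprS.
apply: (@bonami_step _ (cube_mean (fun w => cube_poly aS w ^+ 4)) _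
  (cube_mean (fun w => cube_poly aS w ^+ 2 * cube_poly aR w ^+ 2))
  _ _ _ _ _ _ _ _ _ _ _ IHR).
- by apply: sumr_ge0 => I _; exact: sqr_ge0.
- by apply: sumr_ge0 => I _; exact: sqr_ge0.
- by rewrite exprn_ge0.
- by rewrite -(cube_mean_cst 0) le_cube_mean// => w; rewrite mulr_ge0 ?sqr_ge0.
- have := cube_mean_mul_sqr_le (fun w => cube_poly aS w ^+ 2)
                               (fun w => cube_poly aR w ^+ 2).
  move=> /le_trans; apply; rewrite le_eqVlt; apply/orP; left; apply/eqP.
  by congr (_ * _); apply: eq_cube_mean => w; rewrite -exprM.
- by rewrite -(cube_mean_cst 0) le_cube_mean// => w; rewrite exprn_even_ge0.
- by rewrite -(cube_mean_cst 0) le_cube_mean// => w; rewrite exprn_even_ge0.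
- by rewrite -exprS.
- rewrite (flip_mean (fun x => x ^+ 4)) -cube_meanZ -!cube_meanD.
  apply: eq_cube_mean => w; rewrite [cube_poly aR w ^+ 4](exprM _ 2 2) -!yr.
  by field.
Qed.

Lemma hypercontractivity d (a : {set V} -> R) :
  (forall I, a I != 0 -> (#|I| <= d)%N) ->
  cube_mean (fun w => cube_poly a w ^+ 4) <= 9 ^+ d * (\sum_I a I ^+ 2) ^+ 2.
Proof.
move=> ad; apply: (@bonami_lemma #|V| d setT); first by rewrite cardsT.
by move=> I /ad; rewrite subsetT.
Qed.

End cube.

(** * Stein's method on the cube: integration by parts and third moments *)

Section cube_stein.
Import mathcomp.boot.fintype mathcomp.boot.finset.
Local Close Scope classical_set_scope.
Context {R : realType} {V : finType}.
Implicit Types (w I J K L Z Y : {set V}) (f g : {set V} -> R) (k : V).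

Lemma cube_mean_norm f : `|cube_mean f| <= cube_mean (fun w => `|f w|).
Proof.
rewrite /cube_mean normrM ger0_norm ?invr_ge0 ?exprn_ge0//.
by rewrite ler_wpM2l ?invr_ge0 ?exprn_ge0// ler_norm_sum.
Qed.

Lemma cube_mean_norm_sqr f :
  cube_mean (fun w => `|f w|) ^+ 2 <= cube_mean (fun w => f w ^+ 2).
Proof.
have := cube_mean_mul_sqr_le (fun w => `|f w|) (fun=> 1).
rewrite expr1n cube_mean_cst mulr1.
rewrite (@eq_cube_mean _ _ _ (fun w => `|f w|)); last first.
  by move=> w; rewrite mulr1.
rewrite [X in _ <= X -> _](@eq_cube_mean _ _ _ (fun w => f w ^+ 2))// => w.
by rewrite real_normK// num_real.
Qed.

Definition influence (a : {set V} -> R) k : R :=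
  \sum_(I : {set V} | k \in I) a I ^+ 2.

Lemma influence_part (a : {set V} -> R) k :
  \sum_I part k a I ^+ 2 = influence a k.
Proof.
rewrite /influence [RHS]big_mkcond; apply: eq_bigr => I _; rewrite /part.
by case: (k \in I); rewrite // expr0n.
Qed.

Section homogeneous.
Variables (q : nat) (a : {set V} -> R).
Hypothesis a_card : forall I, a I != 0 -> #|I| = q.

Let y k := cube_poly (part k a).

(** Double counting: every set of the support has [q] elements. This yields both the total influence
    and the Euler identity [sum_part_poly]. *)
Lemma sum_card_weight (h : {set V} -> R) (c : {set V} -> R) :
  (forall I, c I != 0 -> a I != 0) ->
  \sum_k \sum_(I : {set V} | k \in I) c I * h I = q%:R * \sum_I c I * h I.
Proof.
move=> ca; under eq_bigr do rewrite big_mkcond.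
rewrite exchange_big mulr_sumr; apply: eq_bigr => I _ /=.
rewrite -big_mkcond sumr_const mulr_natl.
by have [->|/ca/a_card ->//] := eqVneq (c I) 0; rewrite mul0r !mul0rn.
Qed.

Lemma sum_influence : \sum_k influence a k = q%:R * \sum_I a I ^+ 2.
Proof.
have := sum_card_weight (fun=> 1) (c := fun I => a I ^+ 2).
under eq_bigr do under eq_bigr do rewrite mulr1.
under [in RHS]eq_bigr do rewrite mulr1.
by apply => I; rewrite expf_eq0.
Qed.

Lemma sum_part_poly w : \sum_k y k w = q%:R * cube_poly a w.
Proof.
rewrite -sum_card_weight//; apply: eq_bigr => k _.
rewrite [RHS]big_mkcond; apply: eq_bigr => I _; rewrite /part.
by case: (k \in I); rewrite // mul0r.
Qed.

Lemma part_card k I : part k a I != 0 -> (#|I| <= q)%N.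
Proof. by rewrite /part; case: ifP => [_ /a_card ->|]; rewrite ?eqxx. Qed.

(** Since [y k] is odd under [flip k], pairing each point with its flip replaces [G] by half of its
    increment. The polynomial itself changes by [- 2 * y k], so the Taylor bound leaves the main
    term [y k ^+ 2 * dG] and a remainder [2 * C * |y k|^3]. *)
Lemma cube_integration_by_parts (G dG : R -> R) (C : R) k :
  (forall w u, `|G (cube_poly a u) - G (cube_poly a w) -
     (cube_poly a u - cube_poly a w) * dG (cube_poly a w)| <=
     C * (cube_poly a u - cube_poly a w) ^+ 2) ->
  `|cube_mean (fun w => y k w * G (cube_poly a w)) -
    cube_mean (fun w => y k w ^+ 2 * dG (cube_poly a w))| <=
  2 * C * cube_mean (fun w => `|y k w| ^+ 3).
Proof.
move=> GC; pose p := cube_poly a.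
have -> : cube_mean (fun w => y k w * G (p w)) = cube_mean (fun w =>
    2^-1 * (y k w * (G (p w) - G (p (flip k w))))).
  transitivity (2^-1 * (cube_mean (fun w => y k w * G (p w)) +
      cube_mean ((fun w => y k w * G (p w)) \o flip k))).
    by rewrite cube_mean_flip; lra.
  rewrite -cube_meanD -cube_meanZ; apply: eq_cube_mean => w /=.
  by rewrite /y cube_poly_part_flip; ring.
rewrite -cube_meanB -cube_meanZ; apply: (le_trans (cube_mean_norm _)).
apply: le_cube_mean => w; have := GC w (flip k w).
rewrite -/p; have -> : p (flip k w) - p w = - 2 * y k w.
  by rewrite /p cube_poly_flip /y; ring.
set D := G _ - G _ - _ => DC.
have -> : 2^-1 * (y k w * (G (p w) - G (p (flip k w)))) -
    y k w ^+ 2 * dG (p w) = 2^-1 * (- y k w * D) by rewrite /D; field.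
rewrite !normrM normrN (ger0_norm (x := 2^-1)) ?invr_ge0//.
have -> : 2 * C * `|y k w| ^+ 3 =
    2^-1 * (`|y k w| * (C * (- 2 * `|y k w|) ^+ 2)).
  by field.
have -> : (- 2 * `|y k w|) ^+ 2 = (- 2 * y k w) ^+ 2.
  by rewrite !exprMn real_normK// num_real.
apply: ler_wpM2l; first by rewrite invr_ge0.
exact: ler_wpM2l.
Qed.

(* The squared discrete gradient; its mean is q times the variance of the
   polynomial. *)
Definition Gamma w : R := \sum_k y k w ^+ 2.

(** The inequality [2 z^3 <= l z^2 + z^4 / l] reduces third moments to second ones, which are the
    influences, and to fourth ones, bounded by hypercontractivity. The parameter [l] is left free
    for balancing. *)
Lemma sum_mean_norm_cube (tau l : R) : 0 < l ->
  (forall k, influence a k <= tau) ->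
  2 * \sum_k cube_mean (fun w => `|y k w| ^+ 3) <=
  (l + 9 ^+ q * tau / l) * (q%:R * \sum_I a I ^+ 2).
Proof.
move=> l0 atau; rewrite -sum_influence mulr_sumr mulr_sumr.
apply: ler_sum => k _.
have y2 : cube_mean (fun w => y k w ^+ 2) = influence a k.
  by rewrite cube_poly_mean_sqr influence_part.
have y4 : cube_mean (fun w => y k w ^+ 4) <= 9 ^+ q * influence a k ^+ 2.
  by rewrite -influence_part; apply: hypercontractivity; exact: part_card.
have inf0 : 0 <= influence a k by apply: sumr_ge0 => I _; exact: sqr_ge0.
rewrite -cube_meanZ; apply: (@le_trans _ _
  (cube_mean (fun w => l * y k w ^+ 2 + l^-1 * y k w ^+ 4))).
  apply: le_cube_mean => w; rewrite -(real_normK (num_real (y k w))).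
  rewrite [y k w ^+ 4](exprM _ 2 2) -(real_normK (num_real (y k w))).
  set z := `|y k w|; have z0 : 0 <= z by exact: normr_ge0.
  have : 0 <= (l - z) ^+ 2 * z ^+ 2 / l.
    apply: divr_ge0; last exact: ltW.
    by apply: mulr_ge0; exact: sqr_ge0.
  have -> : (l - z) ^+ 2 * z ^+ 2 / l =
    l * z ^+ 2 + l^-1 * (z ^+ 2) ^+ 2 - 2 * z ^+ 3 by field; rewrite gt_eqF.
  by rewrite subr_ge0.
rewrite cube_meanD !cube_meanZ y2 mulrDl lerD2l.
have := ler_wpM2l (x := l^-1) _ y4.
rewrite invr_ge0 => /(_ (ltW l0))/le_trans; apply.
rewrite [leRHS](_ : _ = l^-1 * (9 ^+ q * (tau * influence a k))); last by ring.
rewrite ler_wpM2l ?invr_ge0 ?(ltW l0)// ler_wpM2l ?exprn_ge0//.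
by rewrite expr2 ler_wpM2r.
Qed.

End homogeneous.
End cube_stein.

(** * The variance of the squared gradient *)

Section gamma_variance.
Import mathcomp.boot.fintype mathcomp.boot.finset.
Local Close Scope classical_set_scope.
Context {R : realType} {V : finType}.
Implicit Types (w I J K L Z Y : {set V}) (p u v : {set V} * {set V}).

(** A pair of disjoint sets with union [Z] is determined by its first entry, a subset of [Z]. *)
Lemma card_disjoint_pairs_le (P : pred ({set V} * {set V})) Z m :
  (forall p, P p -> [/\ [disjoint p.1 & p.2], p.1 :|: p.2 = Z &
                        (#|p.1| + #|p.2| <= m)%N]) ->
  (#|P| <= 2 ^ m)%N.
Proof.
move=> PZ; have [->//|[p0 Pp0]] : #|P| = 0%N \/ exists p, P p.
  have [p Pp|P0] := pickP P; first by right; exists p.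
  by left; apply: eq_card0.
have Zm : (#|Z| <= m)%N.
  have [dp <- ] := PZ _ Pp0; apply: leq_trans.
  by rewrite cardsU (disjoint_setI0 dp) cards0 subn0.
rewrite (leq_trans _ (leq_pexp2l (isT : 0 < 2)%N Zm))// -card_powerset.
have inj1 : {in P &, injective (fun p => p.1)}.
  move=> [A B] [A' B'] /PZ[/= dAB ABZ _] /PZ[/= dAB' ABZ' _] AA'.
  move: ABZ' dAB'; rewrite -{}AA' -ABZ => ABB dAB'.
  congr (_, _); apply/setP => x; move/setP/(_ x): ABB; rewrite !inE.
  have [xA _|_] := boolP (x \in A); last by [].
  by rewrite (disjointFr dAB xA) (disjointFr dAB' xA).
rewrite -(card_in_image inj1); apply: subset_leq_card.
apply/subsetP => _ /imageP[p Pp ->]; rewrite inE.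
by have [_ <- _] := PZ _ Pp; exact: subsetUl.
Qed.

(** By Parseval the left side is the sum of the squared coefficients [e Z]; each collects at most
    [2 ^ m] nonzero terms, to which Cauchy-Schwarz applies. *)
Lemma grouped_mean_sqr (c : {set V} * {set V} -> R) m :
  (forall p, c p != 0 -> [disjoint p.1 & p.2] /\ (#|p.1| + #|p.2| <= m)%N) ->
  cube_mean (fun w => (\sum_p c p * chi (p.1 :|: p.2) w) ^+ 2) <=
  2 ^+ m * \sum_p c p ^+ 2.
Proof.
move=> cP; pose e Z := \sum_(p : {set V} * {set V} | p.1 :|: p.2 == Z) c p.
have eE w : \sum_p c p * chi (p.1 :|: p.2) w = cube_poly e w.
  rewrite (partition_big (fun p => p.1 :|: p.2) xpredT)//=.
  apply: eq_bigr => Z _; rewrite mulr_suml.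
  by apply: eq_bigr => p /eqP ->.
under eq_cube_mean do rewrite eE.
rewrite cube_poly_mean_sqr.
rewrite [X in _ <= _ * X](partition_big (fun p => p.1 :|: p.2) xpredT)//=.
rewrite mulr_sumr; apply: ler_sum => Z _.
pose P := [pred p : {set V} * {set V} | (p.1 :|: p.2 == Z) && (c p != 0)].
have Psum (h : R -> R) : h 0 = 0 ->
    \sum_(p : {set V} * {set V} | p.1 :|: p.2 == Z) h (c p) =
    \sum_(p | P p) h (c p).
  move=> h0; rewrite big_mkcondr; apply: eq_bigr => p _.
  by have [->|//] := eqVneq (c p) 0.
rewrite /e (Psum id)// (Psum (fun x => x ^+ 2)) ?expr0n//.
apply: (le_trans (sqr_sum_le_card P c)).
rewrite ler_wpM2r//; first by apply: sumr_ge0 => p _; exact: sqr_ge0.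
rewrite -natrX ler_nat.
by apply: (@card_disjoint_pairs_le _ Z) => p /andP[/eqP pZ /cP[dp pm]].
Qed.

Variables (q : nat) (a : {set V} -> R).
Hypothesis a_card : forall I, a I != 0 -> #|I| = q.

Definition overlap u :=
  [&& u.1 != u.2, u.1 :&: u.2 != set0, a u.1 != 0 & a u.2 != 0].

(* Grouping the pairs by [differences] and not by symmetric difference costs a
   factor 4^q, but leaves only quadruples that are linked or have a common
   index. *)
Definition differences u := (u.1 :\: u.2, u.2 :\: u.1).

(** In the expanded square a pair of sets occurs once for each common index, hence the weight. The
    diagonal pairs give the constant that is subtracted. *)
Lemma Gamma_centered w : Gamma a w - q%:R * \sum_I a I ^+ 2 =
  \sum_(u | overlap u)
    #|u.1 :&: u.2|%:R * (a u.1 * a u.2) *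
    chi ((differences u).1 :|: (differences u).2) w.
Proof.
pose F I J := #|I :&: J|%:R * (a I * a J) * (chi I w * chi J w).
have -> : Gamma a w = \sum_I \sum_J F I J.
  rewrite /Gamma; under eq_bigr => k _.
    rewrite expr2 /cube_poly big_distrl /=.
    under eq_bigr => I _ do rewrite big_distrr /=.
    over.
  rewrite exchange_big; apply: eq_bigr => I _ /=.
  rewrite exchange_big; apply: eq_bigr => J _ /=.
  transitivity (\sum_(k in I :&: J) a I * a J * (chi I w * chi J w)).
    rewrite [RHS]big_mkcond; apply: eq_bigr => k _; rewrite /part inE.
    by case: (k \in I); case: (k \in J); rewrite /= ?mul0r ?mulr0// mulrACA.
  by rewrite sumr_const -[LHS]mulr_natl mulrA.
rewrite [RHS]big_mkcond -(pair_bigA _ (fun I J => if overlap (I, J) then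
  #|I :&: J|%:R * (a I * a J) * chi ((I :\: J) :|: (J :\: I)) w else 0)) /=.
rewrite mulr_sumr -sumrB; apply: eq_bigr => I _.
rewrite (bigD1 I)//= [in RHS](bigD1 I)//= /overlap /= eqxx /= add0r.
have -> : F I I = q%:R * a I ^+ 2.
  rewrite /F setIid chi_sqr mulr1 expr2.
  by have [->|/a_card ->//] := eqVneq (a I) 0; rewrite !mulr0.
rewrite addrAC subrr add0r; apply: eq_bigr => J JI.
rewrite /F chi_mul (eq_sym I) JI /=.
have [->|IJ] := eqVneq (I :&: J) set0; first by rewrite cards0 !mul0r.
have [->|aI] := eqVneq (a I) 0; first by rewrite !(mul0r, mulr0).
by have [->|//] := eqVneq (a J) 0; rewrite !(mul0r, mulr0).
Qed.

Definition group_coef p : R :=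
  \sum_(u | overlap u && (differences u == p))
    #|u.1 :&: u.2|%:R * (a u.1 * a u.2).

Lemma group_coef_support p : group_coef p != 0 ->
  [disjoint p.1 & p.2] /\ (#|p.1| + #|p.2| <= q + q)%N.
Proof.
move=> cp; have [u /andP[/and4P[_ _ aI aJ] /eqP <-]|nou] :=
    pickP (fun u => overlap u && (differences u == p)); last first.
  by move: cp; rewrite /group_coef big_pred0 ?eqxx.
rewrite /differences /=; split.
  by apply/pred0P => x /=; rewrite !inE; case: (x \in u.1); case: (x \in u.2).
apply: leq_add; [rewrite -(a_card aI)|rewrite -(a_card aJ)];
  exact/subset_leq_card/subsetDl.
Qed.

Lemma Gamma_variance_le :
  cube_mean (fun w => (Gamma a w - q%:R * \sum_I a I ^+ 2) ^+ 2) <=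
  2 ^+ (q + q) * \sum_p group_coef p ^+ 2.
Proof.
apply: le_trans (grouped_mean_sqr group_coef_support).
rewrite le_eqVlt; apply/orP; left; apply/eqP; apply: eq_cube_mean => w.
congr (_ ^+ 2); rewrite Gamma_centered (partition_big differences xpredT)//=.
apply: eq_bigr => p _; rewrite mulr_suml.
by apply: eq_bigr => u /andP[_ /eqP <-].
Qed.

Lemma overlap_swap u : overlap (u.2, u.1) = overlap u.
Proof.
rewrite /overlap /= eq_sym setIC; congr (_ && (_ && _)); exact: andbC.
Qed.

(** With [u = (I, J)] and [v = (K, L)], the product of the four coefficients is split as
    [(a I * a L) * (a J * a K)] before the arithmetic-geometric inequality, because it is [I] and
    [L] that can form a pair of [Fsharp]. Swapping the entries of both pairs exchanges the two
    resulting sums, which are therefore equal. *)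
Lemma sum_group_coef_sqr :
  \sum_p group_coef p ^+ 2 <= q%:R ^+ 2 *
  \sum_(u | overlap u) \sum_(v | overlap v && (differences v == differences u))
     a u.1 ^+ 2 * a v.2 ^+ 2.
Proof.
pose b u := `|a u.1 * a u.2|.
pose B p := \sum_(u | overlap u && (differences u == p)) b u.
have B0 p : 0 <= B p by apply: sumr_ge0 => u _; exact: normr_ge0.
apply: (@le_trans _ _ (\sum_p (q%:R * B p) ^+ 2)).
  apply: ler_sum => p _; rewrite -real_normK ?num_real//.
  rewrite ler_sqr ?nnegrE ?mulr_ge0//.
  apply: (le_trans (ler_norm_sum _ _ _)); rewrite mulr_sumr; apply: ler_sum.
  move=> u /andP[/and4P[_ _ aI _] _]; rewrite normrM normr_nat ler_wpM2r//.
  by rewrite ler_nat -(a_card aI) subset_leq_card// subsetIl.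
have -> : \sum_p (q%:R * B p) ^+ 2 = q%:R ^+ 2 * \sum_p B p ^+ 2.
  by rewrite mulr_sumr; apply: eq_bigr => p _; rewrite exprMn.
apply: ler_wpM2l; first exact: sqr_ge0.
pose T := \sum_(u | overlap u)
  \sum_(v | overlap v && (differences v == differences u)) b u * b v.
have -> : \sum_p B p ^+ 2 = T.
  rewrite /T /B [RHS](partition_big differences xpredT)//=.
  apply: eq_bigr => p _.
  rewrite expr2 mulr_suml; apply: eq_bigr => u /andP[_ /eqP up].
  by rewrite mulr_sumr up.
set S := (X in _ <= X).
have SE : S = \sum_(u | overlap u)
    \sum_(v | overlap v && (differences v == differences u))
    a u.2 ^+ 2 * a v.1 ^+ 2.
  have swapK : involutive (fun u : {set V} * {set V} => (u.2, u.1)) by case.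
  rewrite /S (reindex_inj (inv_inj swapK)); apply: eq_big => [u|u _].
    exact: overlap_swap.
  rewrite (reindex_inj (inv_inj swapK)); apply: eq_bigl => v /=.
  rewrite overlap_swap /differences /=; congr (_ && _).
  by rewrite !xpair_eqE andbC.
suff : 2 * T <= S + S by rewrite -mulr2n -[S *+ 2]mulr_natl ler_pM2l.
rewrite {2}SE /S -big_split /T mulr_sumr; apply: ler_sum => u _ /=.
rewrite -big_split mulr_sumr; apply: ler_sum => v _ /=.
rewrite /b -normrM.
have : 0 <= (`|a u.1 * a v.2| - `|a u.2 * a v.1|) ^+ 2 by exact: sqr_ge0.
rewrite sqrrB !real_normK ?num_real// !exprMn.
have -> : `|a u.1 * a u.2 * (a v.1 * a v.2)| =
    `|a u.1 * a v.2| * `|a u.2 * a v.1| by rewrite -normrM; congr `|_|; ring.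
by rewrite -mulr_natl; lra.
Qed.

(** The counterpart of [Fsharp] for sets, where coincidence up to order of the entries becomes
    equality. *)
Definition linked I L := [&& [disjoint I & L], a I != 0, a L != 0 &
  [exists J, exists K, [&& a J != 0, a K != 0, J :|: K == I :|: L,
    J != I & J != L]]].

(** The witnesses are [J] and [K]: the equal differences give [J :|: K = I :|: L], and for disjoint
    [I] and [L] the set [J] is not [L] because it meets [I]. *)
Lemma overlap_linked I J K L : overlap (I, J) -> overlap (K, L) ->
  differences (K, L) = differences (I, J) -> linked I L || ~~ [disjoint I & L].
Proof.
move=> /and4P[/= IJ IJ0 aI aJ] /and4P[/= KL KL0 aK aL] [KLE LKE].
have [dIL|_] := boolP [disjoint I & L]; last by rewrite orbT.
rewrite /linked dIL aI aL orbF /=.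
apply/existsP; exists J; apply/existsP; exists K.
rewrite aJ aK (eq_sym J I) IJ /=; apply/andP; split; last first.
  by apply: contraNneq IJ0 => ->; rewrite (disjoint_setI0 dIL).
apply/eqP/setP => x; move/setP/(_ x): KLE; move/setP/(_ x): LKE.
move/pred0P/(_ x): dIL; rewrite /= !inE.
by case: (x \in I); case: (x \in J); case: (x \in K); case: (x \in L).
Qed.

(** For fixed [I] and [L], the common differences determine [J] and [K]; they are a subset of [I]
    and a subset of [L]. *)
Lemma card_overlap_le I L :
  (#|[pred u : {set V} * {set V} | [&& overlap (I, u.1), overlap (u.2, L) &
     differences (u.2, L) == differences (I, u.1)]]| <= 2 ^ (q + q))%N.
Proof.
set P := [pred u | _].
have [u0 /and3P[/and4P[_ _ aI _] /and4P[_ _ _ aL] _]|P0] := pickP P; last first.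
  by rewrite eq_card0.
have injP : {in P &, injective (fun u => differences (I, u.1))}.
  move=> [J K] [J' K'] /and3P[_ _ /eqP/= [KLE LKE]].
  move=> /and3P[_ _ /eqP/= [KLE' LKE']].
  move=> [IJ JI]; congr (_, _); apply/setP => x.
    move/setP/(_ x): IJ; move/setP/(_ x): JI; rewrite !inE.
    by case: (x \in I); case: (x \in J); case: (x \in J').
  rewrite IJ in KLE; rewrite JI in LKE.
  rewrite -KLE' in KLE; rewrite -LKE' in LKE.
  move/setP/(_ x): KLE; move/setP/(_ x): LKE; rewrite !inE.
  by case: (x \in L); case: (x \in K); case: (x \in K').
rewrite -(card_in_image injP) expnD -{1}(a_card aI) -(a_card aL).
rewrite -!card_powerset -cardsX; apply: subset_leq_card.
apply/subsetP => _ /imageP[[J K] /and3P[_ _ /eqP/= [KLE LKE]] ->].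
by rewrite inE /= !inE subsetDl /= -LKE subsetDl.
Qed.

Lemma sum_overlap_le :
  \sum_(u | overlap u) \sum_(v | overlap v && (differences v == differences u))
     a u.1 ^+ 2 * a v.2 ^+ 2 <=
  2 ^+ (q + q) *
  \sum_I \sum_(L | linked I L || ~~ [disjoint I & L]) a I ^+ 2 * a L ^+ 2.
Proof.
pose P I J K L := [&& overlap (I, J), overlap (K, L) &
  differences (K, L) == differences (I, J)].
have -> : \sum_(u | overlap u)
    \sum_(v | overlap v && (differences v == differences u))
    a u.1 ^+ 2 * a v.2 ^+ 2 =
  \sum_I \sum_L \sum_(u : {set V} * {set V} | P I u.1 u.2 L)
    a I ^+ 2 * a L ^+ 2.
  pose G I J K L := if P I J K L then a I ^+ 2 * a L ^+ 2 else 0.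
  transitivity (\sum_I \sum_J \sum_K \sum_L G I J K L).
    rewrite (pair_bigA _ (fun I J => \sum_K \sum_L G I J K L)) big_mkcond.
    apply: eq_bigr => -[I J] _ /=; rewrite (pair_bigA _ (G I J)) /G /P.
    case: (overlap (I, J)) => /=; last by rewrite big1.
    by rewrite big_mkcond; apply: eq_bigr => -[K L] _.
  apply: eq_bigr => I _; under eq_bigr do rewrite exchange_big.
  rewrite exchange_big; apply: eq_bigr => L _ /=.
  by rewrite (pair_bigA _ (fun J K => G I J K L)) [RHS]big_mkcond.
rewrite mulr_sumr; apply: ler_sum => I _; rewrite mulr_sumr [leRHS]big_mkcond.
apply: ler_sum => L _ /=; rewrite sumr_const.
case: ifPn => [_|nlinked].
  rewrite -[leLHS]mulr_natl; apply: ler_wpM2r.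
    by rewrite mulr_ge0 ?sqr_ge0.
  by rewrite -natrX ler_nat; exact: card_overlap_le.
rewrite eq_card0// => -[J K]; apply: contraNF nlinked => /and3P[IJ KL /eqP D].
exact: overlap_linked IJ KL D.
Qed.

End gamma_variance.

(** * Normal approximation on the cube *)

Section cube_normal_approximation.
Import mathcomp.boot.fintype mathcomp.boot.finset.
Local Close Scope classical_set_scope.
Context {R : realType} {V : finType}.
Implicit Types (w I J K L : {set V}) (k : V).
Variables (q : nat) (a : {set V} -> R) (delta phi2 : R).
Hypothesis q_gt0 : (0 < q)%N.
Hypothesis a_card : forall I, a I != 0 -> #|I| = q.
Hypothesis a_le1 : \sum_I a I ^+ 2 <= 1.
Hypothesis delta01 : 0 < delta <= 1.
Hypothesis influence_le : forall k, influence a k <= delta ^+ 4.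
Hypothesis phi2_ge0 : 0 <= phi2.
Hypothesis linked_le :
  \sum_I \sum_(L | linked a I L) a I ^+ 2 * a L ^+ 2 <= phi2 ^+ 2.

Let v := \sum_I a I ^+ 2.

(** An intersecting pair is counted at least once in the sum of the squared influences. One
    influence is then bounded by [delta ^+ 4], and the other sums to at most [q]. *)
Lemma sum_intersecting_le :
  \sum_(I : {set V}) \sum_(L : {set V} | ~~ [disjoint I & L])
    a I ^+ 2 * a L ^+ 2 <= q%:R * delta ^+ 4.
Proof.
apply: (@le_trans _ _ (\sum_k influence a k ^+ 2)).
  rewrite [leRHS](_ : _ = \sum_(I : {set V}) \sum_(L : {set V})
      \sum_(k in I :&: L) a I ^+ 2 * a L ^+ 2).
    apply: ler_sum => I _; rewrite big_mkcond; apply: ler_sum => L _.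
    rewrite -setI_eq0 sumr_const -mulr_natl.
    have aIL : 0 <= a I ^+ 2 * a L ^+ 2 by rewrite mulr_ge0 ?sqr_ge0.
    case: ifPn => [|_]; last exact: mulr_ge0.
    by rewrite -card_gt0 => IL; rewrite ler_peMl// ler1n.
  rewrite exchange_big /=.
  transitivity (\sum_k \sum_(I : {set V}) \sum_(L : {set V})
      if k \in I :&: L then a I ^+ 2 * a L ^+ 2 else 0).
    apply: eq_bigr => k _; rewrite expr2 /influence mulr_suml big_mkcond.
    apply: eq_bigr => I _; rewrite mulr_sumr big_mkcond.
    case: ifP => kI; last by rewrite big1// => L _; rewrite inE kI.
    by apply: eq_bigr => L _; rewrite inE kI.
  rewrite exchange_big [RHS]exchange_big; apply: eq_bigr => I _ /=.
  rewrite exchange_big; apply: eq_bigr => L _ /=.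
  by rewrite -big_mkcond.
apply: (@le_trans _ _ (\sum_k delta ^+ 4 * influence a k)).
  apply: ler_sum => k _; rewrite expr2 ler_wpM2r//.
  by apply: sumr_ge0 => I _; exact: sqr_ge0.
rewrite -mulr_sumr (sum_influence a_card) mulrC ler_wpM2r ?exprn_even_ge0//.
by rewrite ler_piMr.
Qed.

(** The first moment is bounded through the second. In the variance one factor [4 ^+ q] comes from
    grouping by differences, the other from counting the middle sets [J] and [K], so the square root
    retains one. *)
Lemma Gamma_deviation_le : cube_mean (fun w => `|Gamma a w - q%:R * v|) <=
  q%:R * 4 ^+ q * (phi2 + q%:R * delta ^+ 2).
Proof.
have q1 : 1 <= q%:R :> R by rewrite ler1n.
have /andP[d0 _] := delta01.
rewrite -ler_sqr ?nnegrE; last 2 first.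
- by rewrite -(@cube_mean_cst _ V 0) le_cube_mean// => w; exact: normr_ge0.
- by rewrite !mulr_ge0 ?exprn_ge0// addr_ge0// mulr_ge0// sqr_ge0.
apply: (le_trans (cube_mean_norm_sqr _)).
apply: (le_trans (Gamma_variance_le a_card)).
have E : 2 ^+ (q + q) = 4 ^+ q :> R.
  by rewrite exprD -exprMn; congr (_ ^+ _); lra.
have := sum_overlap_le a_card; rewrite E.
set S := \sum_(u | _) _ => S_le.
have : \sum_p group_coef a p ^+ 2 <= q%:R ^+ 2 * S := sum_group_coef_sqr a_card.
have {}S_le : S <= 4 ^+ q * (phi2 ^+ 2 + q%:R * delta ^+ 4).
  apply: (le_trans S_le); rewrite ler_wpM2l ?exprn_ge0//.
  apply: le_trans (lerD linked_le sum_intersecting_le).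
  rewrite -big_split; apply: ler_sum => I _ /=.
  rewrite [X in _ <= X + _]big_mkcond [X in _ <= _ + X]big_mkcond -big_split.
  rewrite [leLHS]big_mkcond; apply: ler_sum => L _ /=.
  have : 0 <= a I ^+ 2 * a L ^+ 2 by rewrite mulr_ge0 ?sqr_ge0.
  by case: (linked a I L); case: [disjoint I & L] => /=; lra.
move=> /le_trans/(_ (ler_wpM2l (sqr_ge0 _) S_le)) group_le.
apply: (le_trans (ler_wpM2l _ group_le)); first by rewrite exprn_ge0.
rewrite [leLHS](_ : _ =
  (q%:R * 4 ^+ q) ^+ 2 * (phi2 ^+ 2 + q%:R * delta ^+ 4)); last by ring.
rewrite [leRHS]exprMn; apply: ler_wpM2l; first exact: sqr_ge0.
have d2 : 0 <= delta ^+ 2 by exact: sqr_ge0.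
have -> : delta ^+ 4 = (delta ^+ 2) ^+ 2 by rewrite -exprM.
move: (delta ^+ 2) d2 => e e0; have : 0 <= phi2 * (q%:R * e).
  by rewrite !mulr_ge0.
have : 0 <= q%:R * e ^+ 2 * (q%:R - 1).
  by rewrite !mulr_ge0 ?sqr_ge0 ?subr_ge0.
by nra.
Qed.

(** The term [1 - v] is the variance missing after truncation. The terms with [4 ^+ q] come from the
    deviation of [Gamma], the one with [9 ^+ q] from the Taylor remainder; the factors 2 are the
    bound on [dG]. *)
Definition stein_error : R :=
  2 * (1 - v) + 2 * 4 ^+ q * phi2 +
  (2 * 4 ^+ q * q%:R + 4 * (1 + 9 ^+ q)) * delta.

Lemma cube_stein_bound (G dG : R -> R) :
  (forall w u, `|G (cube_poly a u) - G (cube_poly a w) -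
     (cube_poly a u - cube_poly a w) * dG (cube_poly a w)| <=
     4 / delta * (cube_poly a u - cube_poly a w) ^+ 2) ->
  (forall w, `|dG (cube_poly a w)| <= 2) ->
  `|cube_mean (fun w => dG (cube_poly a w) - cube_poly a w * G (cube_poly a w))|
    <= stein_error.
Proof.
move=> G_taylor dG2; have /andP[d0 d1] := delta01.
pose p := cube_poly a; pose y k := cube_poly (part k a).
have q0 : 0 < q%:R :> R by rewrite ltr0n.
(* By [sum_part_poly] the product of [q] and the polynomial is the sum of the [y k], which prepares
   integration by parts in each coordinate. *)
have qE : q%:R * cube_mean (fun w => dG (p w) - p w * G (p w)) =
    cube_mean (fun w => dG (p w) * (q%:R - Gamma a w)) -
    \sum_k (cube_mean (fun w => y k w * G (p w)) -
            cube_mean (fun w => y k w ^+ 2 * dG (p w))).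
  rewrite sumrB -!cube_mean_sum -!cube_meanB -cube_meanZ.
  apply: eq_cube_mean => w.
  rewrite -!mulr_suml (sum_part_poly a_card) /Gamma /p.
  by ring.
have d20 : 0 < delta ^+ 2 by rewrite exprn_gt0.
(* With [l = delta ^+ 2] both terms of the bound are multiples of [delta ^+ 2], which the factor
   [4 / delta] brings to order [delta]. *)
have cube_le := sum_mean_norm_cube a_card d20 influence_le.
have ibp_le : `|\sum_k (cube_mean (fun w => y k w * G (p w)) -
            cube_mean (fun w => y k w ^+ 2 * dG (p w)))| <=
    q%:R * (4 * (1 + 9 ^+ q) * delta).
  apply: (le_trans (ler_norm_sum _ _ _)); apply: (@le_trans _ _
    (\sum_k 2 * (4 / delta) * cube_mean (fun w => `|y k w| ^+ 3))).
    by apply: ler_sum => k _; exact: cube_integration_by_parts.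
  rewrite -mulr_sumr -mulrA mulrCA.
  apply: (@le_trans _ _ (4 / delta *
      ((delta ^+ 2 + 9 ^+ q * delta ^+ 4 / delta ^+ 2) *
       (q%:R * \sum_I a I ^+ 2)))).
    by rewrite ler_wpM2l ?divr_ge0// ltW.
  rewrite [leLHS](_ : _ = q%:R * (4 * (1 + 9 ^+ q) * delta) * v); last first.
    by rewrite /v; field; rewrite gt_eqF.
  by rewrite ler_piMr// !mulr_ge0 ?addr_ge0 ?exprn_ge0// ltW.
have gamma_le : `|cube_mean (fun w => dG (p w) * (q%:R - Gamma a w))| <=
    q%:R * (2 * (1 - v) + 2 * 4 ^+ q * phi2 + 2 * 4 ^+ q * q%:R * delta).
  apply: (le_trans (cube_mean_norm _)); apply: (@le_trans _ _ (cube_mean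
      (fun w => 2 * (q%:R * (1 - v) + `|Gamma a w - q%:R * v|)))).
    apply: le_cube_mean => w; rewrite normrM ler_pM//.
    have -> : q%:R - Gamma a w =
      q%:R * (1 - v) - (Gamma a w - q%:R * v) by ring.
    apply: (le_trans (ler_normB _ _)); rewrite lerD2r ger0_norm//.
    by rewrite mulr_ge0// subr_ge0.
  rewrite cube_meanZ cube_meanD cube_mean_cst.
  have := Gamma_deviation_le.
  have d2d : q%:R * 4 ^+ q * (q%:R * delta ^+ 2) <=
      q%:R * 4 ^+ q * (q%:R * delta).
    by rewrite !ler_wpM2l ?mulr_ge0 ?exprn_ge0// expr2 ler_piMr// ltW.
  by lra.
rewrite -(ler_pM2l q0) -{1}(ger0_norm (ltW q0)) -normrM qE.
apply: (le_trans (ler_normB _ _)); apply: (le_trans (lerD gamma_le ibp_le)).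
by rewrite /stein_error; lra.
Qed.

(** The smoothed Stein equation encloses [dG w - w * G w] between two indicators, up to constants;
    taking means at the values of the polynomial gives the two one-sided estimates. *)
Lemma cube_normal_approximation (c phi : R -> R) (z : R) :
  standard_normal_pair c phi ->
  cube_mean (fun w => (cube_poly a w <= z - delta)%R%:R) - c z <= stein_error /\
  c z - cube_mean (fun w => (cube_poly a w <= z)%R%:R) <=
    stein_error + delta / phi 0.
Proof.
move=> cphi; have /andP[d0 _] := delta01.
have [A pA] : exists A, forall w, A < cube_poly a w.
  exists (- \sum_w `|cube_poly a w| - 1) => w.
  rewrite (bigD1 w)//=; have := ler_norm (- cube_poly a w); rewrite normrN.
  have : 0 <= \sum_(w' | w' != w) `|cube_poly a w'|.
    by apply: sumr_ge0 => ? _; exact: normr_ge0.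
  by lra.
have [G [dG GP]] := smoothed_stein_solution cphi z A d0.
have G_taylor w u : `|G (cube_poly a u) - G (cube_poly a w) -
     (cube_poly a u - cube_poly a w) * dG (cube_poly a w)| <=
     4 / delta * (cube_poly a u - cube_poly a w) ^+ 2.
  by have [+ _ _ _] := GP _ (pA w); apply.
have dG2 w : `|dG (cube_poly a w)| <= 2 by have [] := GP _ (pA w).
have := cube_stein_bound G_taylor dG2; rewrite ler_norml => /andP[lo hi]; split.
  apply: le_trans hi; rewrite -[X in _ - X](@cube_mean_cst _ V) -cube_meanB.
  by apply: le_cube_mean => w; have [] := GP _ (pA w).
have : cube_mean (fun w =>
      dG (cube_poly a w) - cube_poly a w * G (cube_poly a w)) <=
    cube_mean (fun w => (cube_poly a w <= z)%R%:R - (c z - delta / phi 0)).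
  by apply: le_cube_mean => w; have [_ _ _] := GP _ (pA w); lra.
by rewrite [X in _ <= X -> _]cube_meanB cube_mean_cst; lra.
Qed.

End cube_normal_approximation.

(** * Truncation of the index set *)

Section product_measure.
Context {R : realType} (b : nat -> R).
Hypothesis b_summable : square_summable b.

Let prod_sqr_ge0 (t : seq nat) : 0 <= \prod_(i <- t) b i ^+ 2.
Proof. by apply: prodr_ge0 => i _; exact: sqr_ge0. Qed.

Lemma mu_pow_ge0 m (A : set (m.-tuple nat)) : (0 <= mu_pow b A)%E.
Proof. by apply: esum_ge0 => t _; rewrite lee_fin. Qed.

Lemma le_mu_pow m (A B : set (m.-tuple nat)) :
  A `<=` B -> (mu_pow b A <= mu_pow b B)%E.
Proof.
move=> AB; rewrite /mu_pow [leRHS](esumID A)//; last first.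
  by move=> t _; rewrite lee_fin.
by rewrite (setIidr AB) leeDl// esum_ge0// => t _; rewrite lee_fin.
Qed.

(** The whole space is a rectangle, of mass the [m]-th power of the sum of the [b i ^+ 2]. *)
Lemma mu_pow_fin_num m (A : set (m.-tuple nat)) : mu_pow b A \is a fin_num.
Proof.
rewrite ge0_fin_numE ?mu_pow_ge0//.
apply: le_lt_trans (le_mu_pow (@subsetT _ A)) _.
rewrite -ge0_fin_numE ?mu_pow_ge0//.
have -> : [set: m.-tuple nat] =
    [set t | forall k : 'I_m, (fun=> setT : set nat) k (tnth t k)].
  by apply/seteqP; split.
rewrite (@mu_pow_rect _ b m (fun=> setT)); apply: prode_fin_num => i _.
rewrite /mu_b -nneseries_esumT; last by move=> k; rewrite lee_fin sqr_ge0.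
rewrite (_ : limn _ = limn (EFin \o series (fun i => b i ^+ 2))).
  by rewrite EFin_lim.
by congr (limn _); apply/funext => n /=; rewrite sumEFin.
Qed.

Lemma sum_le_mu_pow m (A : set (m.-tuple nat)) (T : finType) (P : pred T)
    (g : T -> m.-tuple nat) :
  {in P &, injective g} -> (forall x, P x -> A (g x)) ->
  \sum_(x | P x) \prod_(i <- g x) b i ^+ 2 <= fine (mu_pow b A).
Proof.
move=> ginj gA; rewrite -lee_fin fineK; last exact: mu_pow_fin_num.
apply: esum_ge; exists [set` [seq g x | x <- enum P]].
  split; first exact: finite_seq.
  by move=> t /= /mapP[x]; rewrite mem_enum => Px ->; exact: gA.
rewrite -fsbig_seq; last first.
  rewrite map_inj_in_uniq ?enum_uniq// => x y.
  by rewrite !mem_enum; exact: ginj.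
by rewrite big_map big_enum sumEFin.
Qed.

Definition lift_tuple (n m : nat) (s : m.-tuple 'I_n) : m.-tuple nat :=
  [tuple of map val s].

Lemma lift_tuple_inj n m : injective (@lift_tuple n m).
Proof.
move=> s t st; apply/val_inj/(inj_map val_inj).
exact: (congr1 val st : map val s = map val t).
Qed.

Lemma lift_tuple_surj n m (t : m.-tuple nat) :
  (forall i, i \in t -> (i < n)%N) ->
  exists s : m.-tuple 'I_n, t = lift_tuple s.
Proof.
move=> tn; have tk k : (tnth t k < n)%N by apply: tn; exact: mem_tnth.
exists [tuple Ordinal (tk k) | k < m]; apply: eq_from_tnth => k.
by rewrite tnth_map tnth_mktuple.
Qed.

Lemma entries_bounded m (r : seq (m.-tuple nat)) :
  exists n0, forall t, t \in r -> forall i, i \in t -> (i < n0)%N.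
Proof.
elim: r => [|t r [n0 rn0]]; first by exists 0%N.
exists (maxn n0 (\max_(i <- t) i).+1) => u; rewrite inE => /predU1P[->|ur] i iu.
  by rewrite leq_max ltnS (leq_bigmax_seq (F := id)) ?orbT.
by rewrite leq_max (rn0 u).
Qed.

(** The extended sum is a supremum over finite sets, and each of these fits into a box of tuples
    with entries below some [n0]. *)
Lemma mu_pow_approx m (A : set (m.-tuple nat)) (e : R) : 0 < e ->
  exists n0, forall n, (n0 <= n)%N ->
    fine (mu_pow b A) - e <
    \sum_(s : m.-tuple 'I_n | `[< A (lift_tuple s) >])
       \prod_(i <- lift_tuple s) b i ^+ 2.
Proof.
move=> e0; have [_ [X [Xfin XA] <-]] :=
  ub_ereal_sup_adherent e0 (mu_pow_fin_num A).
rewrite -/(mu_pow b A) => Xlt.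
have [n0 Xn0] := entries_bounded (fset_set X).
exists n0 => n n0n; rewrite -lte_fin EFinB fineK ?mu_pow_fin_num//.
apply: (lt_le_trans Xlt).
pose P (s : m.-tuple 'I_n) := `[< A (lift_tuple s) >].
have -> : (\sum_(s | P s) \prod_(i <- lift_tuple s) b i ^+ 2)%:E =
    (\sum_(t \in [set` [seq lift_tuple s | s <- enum P]])
      (\prod_(i <- t) b i ^+ 2)%:E)%E.
  rewrite -fsbig_seq; last first.
    by rewrite map_inj_uniq ?enum_uniq//; exact: lift_tuple_inj.
  by rewrite big_map big_enum sumEFin.
apply: lee_fsum_nneg_subset => //; first exact: finite_seq.
  move=> t; rewrite !inE => Xt; have [|s tE] := @lift_tuple_surj n m t.
    by move=> i it; apply: leq_trans n0n; apply: (Xn0 t) => //;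
      rewrite in_fset_set// inE.
  apply/mapP; exists s => //; rewrite mem_enum; apply/asboolP.
  by rewrite -tE; exact: XA.
by move=> t _; rewrite lee_fin.
Qed.

End product_measure.

(** * Coefficients of the truncated chaos sum *)

Section chaos_coefficients.
Context {R : realType} (b : nat -> R) (q n : nat) (F : set (q.-tuple nat)).
Hypothesis b_summable : square_summable b.
Hypothesis F_Delta : F `<=` Delta q.
Hypothesis F_sym : symmetric_set F.
Hypothesis F_pos : (0 < mu_pow b F)%E.
Implicit Types (s t : q.-tuple 'I_n) (I J K L : {set 'I_n}).

Let M := fine (mu_pow b F).

Lemma mass_gt0 : 0 < M.
Proof. by rewrite -lte_fin fineK// mu_pow_fin_num. Qed.

Definition entries s : {set 'I_n} := [set x in s].

Definition system I : bool :=
  `[< exists2 s, F (lift_tuple s) & entries s = I >].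

Lemma lift_uniq s : F (lift_tuple s) -> uniq s.
Proof.
by move=> /F_Delta; rewrite /Delta /= map_inj_uniq//; exact: val_inj.
Qed.

Lemma system_entries s : F (lift_tuple s) -> system (entries s).
Proof. by move=> Fs; apply/asboolP; exists s. Qed.

Lemma card_entries s : uniq s -> #|entries s| = q.
Proof. by move=> us; rewrite cardsE (card_uniqP us) size_tuple. Qed.

Lemma system_card I : system I -> #|I| = q.
Proof. by move=> /asboolP[s /lift_uniq us <-]; exact: card_entries. Qed.

Lemma system_lift s : uniq s -> system (entries s) -> F (lift_tuple s).
Proof.
move=> us /asboolP[t Ft ts]; apply: (F_sym _ Ft); apply: perm_map.
apply: uniq_perm => // [|x]; first exact: lift_uniq.
by move/setP/(_ x): ts; rewrite !inE.
Qed.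

(** By symmetry of [F], a set of the system is the entry set of exactly q! tuples of [F], namely all
    its orderings. *)
Lemma sum_lift (h : {set 'I_n} -> R) :
  \sum_(s | `[< F (lift_tuple s) >]) h (entries s) =
  q`!%:R * \sum_(I | system I) h I.
Proof.
rewrite (partition_big entries system) /=; last first.
  by move=> s /asboolP; exact: system_entries.
rewrite mulr_sumr; apply: eq_bigr => I sysI.
under eq_bigr => s /andP[_ /eqP ->] do over.
rewrite sumr_const -[LHS]mulr_natl; congr (_%:R * _).
have -> : (q`! = #|I| ^_ q)%N by rewrite (system_card sysI) ffactnn.
rewrite -card_uniq_tuples cardsE.
apply: eq_card => s; rewrite /in_mem /=.
apply/andP/andP => [[/asboolP Fs /eqP sI]|].
  split; last exact: lift_uniq.
  by apply/allP => x xs; suff: x \in I by []; rewrite -sI inE.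
move=> [/allP sI us]; have sIE : entries s = I.
  apply/eqP; rewrite eqEcard card_entries// (system_card sysI) leqnn andbT.
  by apply/fintype.subsetP => x; rewrite inE; exact: sI.
split; last exact/eqP.
by apply/asboolP/system_lift => //; rewrite sIE.
Qed.

Lemma prod_lift (f : nat -> R) s : uniq s ->
  \prod_(i <- lift_tuple s) f i = \prod_(i in entries s) f i.
Proof.
by move=> us; rewrite big_map big_uniq//=; apply: eq_bigl => i; rewrite inE.
Qed.

(** All q! orderings of [I] contribute the same monomial. The normalization keeps the mass [M] of
    the whole of [F], so the squares sum to at most 1 and approach 1 as [n] grows. *)
Definition coef I : R :=
  if system I then q`!%:R / Num.sqrt (q`!%:R * M) * \prod_(i in I) b i else 0.

Lemma coef_system I : coef I != 0 -> system I.
Proof. by rewrite /coef; case: ifP; rewrite ?eqxx. Qed.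

Lemma coef_card I : coef I != 0 -> #|I| = q.
Proof. by move=> /coef_system/system_card. Qed.

Lemma coef_sqr I : system I ->
  coef I ^+ 2 = q`!%:R / M * \prod_(i in I) b i ^+ 2.
Proof.
move=> sysI; have M0 := mass_gt0; have qf0 : 0 < q`!%:R :> R.
  by rewrite ltr0n fact_gt0.
rewrite /coef sysI exprMn -prodrXl; congr (_ * _).
rewrite expr_div_n sqr_sqrtr; last by rewrite mulr_ge0// ltW.
by field; rewrite !gt_eqF.
Qed.

Lemma sum_coef_sqr (P : pred {set 'I_n}) :
  \sum_(I | P I) coef I ^+ 2 = M^-1 *
  \sum_(s | `[< F (lift_tuple s) >] && P (entries s))
     \prod_(i <- lift_tuple s) b i ^+ 2.
Proof.
have qf0 : q`!%:R != 0 :> R by rewrite pnatr_eq0 -lt0n fact_gt0.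
pose h I := if P I then \prod_(i in I) b i ^+ 2 else 0.
transitivity (q`!%:R / M * \sum_(I | system I) h I); last first.
  rewrite mulrAC -sum_lift mulrC; congr (_ * _); rewrite [RHS]big_mkcondr.
  apply: eq_bigr => s /asboolP/lift_uniq us; rewrite /h.
  by case: ifP => // _; rewrite prod_lift.
rewrite mulr_sumr [LHS]big_mkcond [RHS]big_mkcond; apply: eq_bigr => I _ /=.
rewrite /h; have [sysI|sysI] := boolP (system I); last first.
  by rewrite /coef (negbTE sysI) expr0n if_same.
by case: ifP => _; rewrite ?mulr0// coef_sqr.
Qed.

Lemma sum_coef_sqr_le1 : \sum_I coef I ^+ 2 <= 1.
Proof.
rewrite sum_coef_sqr mulrC ler_pdivrMr ?mass_gt0// mul1r.
apply: sum_le_mu_pow => // [s t _ _|s]; first exact: lift_tuple_inj.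
by rewrite andbT => /asboolP.
Qed.

Lemma influence_coef_le k : influence coef k <= Psi b F k.
Proof.
rewrite /influence sum_coef_sqr mulrC /Psi.
apply: ler_wpM2r; first by rewrite invr_ge0 ltW// mass_gt0.
apply: sum_le_mu_pow => // [s t _ _|s]; first exact: lift_tuple_inj.
move=> /andP[/asboolP Fs ks]; split=> //=.
by rewrite map_f//; move: ks; rewrite inE.
Qed.

Lemma lift_perm_entries s t :
  perm_eq (lift_tuple s) (lift_tuple t) -> entries s = entries t.
Proof.
move=> /perm_mem st; apply/setP => x; rewrite !inE.
by have := st (val x); rewrite !mem_map//; exact: val_inj.
Qed.

Lemma linked_Fsharp s t : F (lift_tuple s) -> F (lift_tuple t) ->
  linked coef (entries s) (entries t) -> Fsharp F (lift_tuple s, lift_tuple t).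
Proof.
move=> Fs Ft /and4P[dst _ _ /existsP[J /existsP[K]]].
move=> /and5P[/coef_system/asboolP[j Fj <-] /coef_system/asboolP[k Fk <-]].
move=> /eqP jk jns jnt; split=> //=.
  move=> _ /mapP[x xs ->]; rewrite mem_map; last exact: val_inj.
  by have := disjointFr dst (x := x); rewrite !inE => ->.
exists (lift_tuple j), (lift_tuple k); split=> //=.
- move=> x; rewrite !mem_cat; apply/orP/orP => -[] /mapP[y yj ->].
  + have : y \in entries s :|: entries t by rewrite -jk !inE yj.
    by rewrite !inE => /orP[] /(map_f val); [left|right].
  + have : y \in entries s :|: entries t by rewrite -jk !inE yj orbT.
    by rewrite !inE => /orP[] /(map_f val); [left|right].
  + have : y \in entries j :|: entries k by rewrite jk !inE yj.
    by rewrite !inE => /orP[] /(map_f val); [left|right].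
  + have : y \in entries j :|: entries k by rewrite jk !inE yj orbT.
    by rewrite !inE => /orP[] /(map_f val); [left|right].
- by apply: contra jns => /lift_perm_entries ->.
- by apply: contra jnt => /lift_perm_entries ->.
Qed.

(** Two uses of [sum_coef_sqr] turn pairs of sets into pairs of tuples, which concatenation embeds
    injectively into the image of [Fsharp F]. *)
Lemma sum_linked_coef_le :
  \sum_I \sum_(L | linked coef I L) coef I ^+ 2 * coef L ^+ 2 <= Phi b F ^+ 2.
Proof.
have M0 := mass_gt0.
have -> : Phi b F ^+ 2 = M^-1 ^+ 2 *
    fine (mu_pow b [set [tuple of ij.1 ++ ij.2] | ij in Fsharp F]).
  rewrite /Phi exprMn sqr_sqrtr ?fine_ge0 ?mu_pow_ge0//.
  by rewrite mulrC.
pose P (u : q.-tuple 'I_n * q.-tuple 'I_n) := [&& `[< F (lift_tuple u.1) >],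
  `[< F (lift_tuple u.2) >] & linked coef (entries u.1) (entries u.2)].
apply: (@le_trans _ _ (M^-1 ^+ 2 * \sum_(u | P u)
    \prod_(i <- [tuple of lift_tuple u.1 ++ lift_tuple u.2]) b i ^+ 2));
  last first.
  rewrite ler_wpM2l ?sqr_ge0//; apply: sum_le_mu_pow => //.
    move=> [s t] [s' t'] _ _ /= /(congr1 val)/= /eqP.
    rewrite eqseq_cat ?size_map ?size_tuple// => /andP[/eqP ss' /eqP tt'].
    by congr (_, _); apply: lift_tuple_inj; apply: val_inj.
  move=> [s t] /and3P[/asboolP Fs /asboolP Ft /= st].
  by exists (lift_tuple s, lift_tuple t) => //; exact: linked_Fsharp.
rewrite le_eqVlt; apply/orP; left; apply/eqP.
pose w t : R := \prod_(i <- lift_tuple t) b i ^+ 2.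
transitivity (\sum_I M^-1 * \sum_(t | `[< F (lift_tuple t) >] &&
    linked coef I (entries t)) coef I ^+ 2 * w t).
  apply: eq_bigr => I _; rewrite -mulr_sumr sum_coef_sqr mulrCA; congr (_ * _).
  by rewrite mulr_sumr.
rewrite -mulr_sumr expr2 -mulrA; congr (_ * _).
under eq_bigr do rewrite big_mkcond.
rewrite exchange_big /=.
transitivity (\sum_(t | `[< F (lift_tuple t) >]) w t *
    \sum_(I | linked coef I (entries t)) coef I ^+ 2).
  rewrite [RHS]big_mkcond; apply: eq_bigr => t _; case: ifP => _ /=; last first.
    by rewrite big1.
  by rewrite -big_mkcond mulr_sumr; apply: eq_bigr => I _; rewrite mulrC.
transitivity (\sum_(t | `[< F (lift_tuple t) >]) M^-1 * (w t *
    \sum_(s | `[< F (lift_tuple s) >] &&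
              linked coef (entries s) (entries t)) w s)).
  apply: eq_bigr => t _; rewrite mulrCA; congr (_ * _).
  exact: (sum_coef_sqr (fun I => linked coef I (entries t))).
rewrite -mulr_sumr; congr (_ * _).
rewrite [LHS]big_mkcond.
transitivity (\sum_t \sum_s if P (s, t) then w s * w t else 0).
  apply: eq_bigr => t _; rewrite /P /=; case: (`[< F (lift_tuple t) >]) => /=.
    by rewrite mulr_sumr big_mkcond; apply: eq_bigr => s _; rewrite mulrC.
  by rewrite big1// => s _; rewrite andbF.
rewrite exchange_big.
rewrite (pair_bigA _ (fun s t => if P (s, t) then w s * w t else 0)).
rewrite -big_mkcond; apply: eq_big => [[s t]//|[s t] _] /=.
by rewrite big_cat.
Qed.

End chaos_coefficients.

(** * From the cube to the probability space *)

Section cube_of_signs.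
Context {R : realType} {d : measure_display} {T : measurableType d}
  {P : probability T R} (X : nat -> {RV P >-> R}).
Hypothesis X_rad : rademacher_sequence X.

(** Indexed by natural numbers, not ordinals, in order to match [mutually_independent]. *)
Definition sign_event n (w : {set 'I_n}) : set T :=
  \bigcap_(i in [set` iota 0 n])
    (X i @^-1` [set (-1) ^+ (i \in [seq val j | j <- enum w])]).

Lemma sign_eventP n (w : {set 'I_n}) x :
  sign_event w x <-> forall i : 'I_n, X i x = (-1) ^+ (i \in w).
Proof.
have valw (i : 'I_n) : (val i \in [seq val j | j <- enum w]) = (i \in w).
  by rewrite mem_map ?mem_enum//; exact: val_inj.
split=> [xw i|xw i].
  by rewrite -valw; apply: (xw (val i)); rewrite /= mem_iota ltn_ord.
by rewrite /= mem_iota => /= ilt; rewrite (xw (Ordinal ilt)) -valw.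
Qed.

Lemma measurable_sign_event n (w : {set 'I_n}) : measurable (sign_event w).
Proof.
apply: fin_bigcap_measurable; first exact: finite_seq.
by move=> i _; rewrite -[X in measurable X]setTI; exact: measurable_funP.
Qed.

Lemma probability_sign_event n (w : {set 'I_n}) :
  P (sign_event w) = ((2 ^+ n)^-1)%:E.
Proof.
have [X_ind X_pm] := X_rad.
rewrite /sign_event (X_ind _ (fun i =>
  [set (-1) ^+ (i \in [seq val j | j <- enum w])])).
- rewrite (eq_bigr (fun=> (2^-1)%:E)); last first.
    move=> i _; have [P1 PN1] := X_pm i.
    by case: (i \in _); rewrite ?expr1 ?expr0.
  by rewrite prodEFin big_const_seq count_predT size_iota iter_mulr_1 exprVn.
- exact: iota_uniq.
- by move=> i; exact: measurable_set1.
Qed.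

(** The sign patterns are disjoint events of probability [2^-n]. This is an inequality because [B]
    may also contain outcomes where [X] leaves {-1, 1}; two-sided estimates come from applying it to
    complementary half-lines. *)
Lemma cube_mean_le_probability n (Q : pred {set 'I_n}) (B : set T) :
  measurable B ->
  (forall w x, Q w -> (forall i : 'I_n, X i x = (-1) ^+ (i \in w)) -> B x) ->
  cube_mean (fun w => (Q w)%:R) <= fine (P B).
Proof.
move=> mB QB; rewrite -lee_fin fineK; last exact: fin_num_measure.
have UB : \bigcup_(w in [set` enum Q]) sign_event w `<=` B.
  by move=> x [w /=]; rewrite mem_enum => Qw /sign_eventP; exact: QB.
have mU : measurable (\bigcup_(w in [set` enum Q]) sign_event w).
  apply: fin_bigcup_measurable; first exact: finite_seq.
  by move=> w _; exact: measurable_sign_event.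
apply: le_trans (le_measure P _ _ UB); rewrite ?inE//.
rewrite measure_fin_bigcup; last 3 first.
- exact: finite_seq.
- move=> w w' _ _ [x [/sign_eventP xw /sign_eventP xw']].
  apply/setP => i; have := xw i; rewrite xw'.
  by case: (i \in w); case: (i \in w') => //; rewrite expr0 expr1; lra.
- by move=> w _; exact: measurable_sign_event.
rewrite -fsbig_seq ?enum_uniq// big_enum.
rewrite (eq_bigr (fun=> ((2 ^+ n)^-1)%:E)); last first.
  by move=> w _; exact: probability_sign_event.
rewrite sumEFin lee_fin /cube_mean card_ord mulr_sumr [leRHS]big_mkcond /=.
by apply: ler_sum => w _; rewrite unfold_in; case: (Q w); rewrite ?mulr1 ?mulr0.
Qed.

End cube_of_signs.

(** * Partial sums over boxes and their distance to the chaos sum *)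

Section truncation.
Context {R : realType} {d : measure_display} {T : measurableType d}
  {P : probability T R} (X : nat -> {RV P >-> R}).
Context (b : nat -> R) (q : nat) (F : set (q.-tuple nat)).
Hypothesis F_Delta : F `<=` Delta q.
Hypothesis F_sym : symmetric_set F.

Definition box n : {fset q.-tuple nat} :=
  seq_fset tt [seq lift_tuple s | s <- enum {: q.-tuple 'I_n}].

Lemma big_box n (f : q.-tuple nat -> R) (Q : pred (q.-tuple nat)) :
  \sum_(t <- box n | Q t) f t =
  \sum_(s : q.-tuple 'I_n | Q (lift_tuple s)) f (lift_tuple s).
Proof.
rewrite (perm_big _ (seq_fset_perm _ _)) undup_id; last first.
  by rewrite map_inj_uniq ?enum_uniq//; exact: lift_tuple_inj.
by rewrite big_map big_enum_cond.
Qed.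

Lemma chaos_box n (w : {set 'I_n}) x :
  (forall i : 'I_n, X i x = (-1) ^+ (i \in w)) ->
  chaos_partial_sum X b F (box n) x = cube_poly (coef b F) w.
Proof.
move=> xw; rewrite /chaos_partial_sum big_box.
pose h (I : {set 'I_n}) := (\prod_(i in I) b i) * chi I w.
transitivity ((Num.sqrt (q`!%:R * fine (mu_pow b F)))^-1 *
    \sum_(s : q.-tuple 'I_n | `[< F (lift_tuple s) >]) h (entries s)).
  congr (_ * _); apply: eq_big => [s|s].
    by apply/idP/asboolP => [/set_mem|/mem_set].
  move=> /set_mem/(lift_uniq F_Delta) us; rewrite !prod_lift//; congr (_ * _).
  by apply: eq_bigr => i _; rewrite xw.
rewrite sum_lift// mulrA mulr_sumr [LHS]big_mkcond; apply: eq_bigr => I _.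
rewrite /coef; case: ifP => _; last by rewrite mul0r.
by rewrite /h mulrA (mulrC (_^-1)).
Qed.

Lemma measurable_chaos_partial_sum A :
  measurable_fun setT (chaos_partial_sum X b F A).
Proof.
apply: measurable_funM; first exact: measurable_cst.
rewrite (_ : (fun _ => _) = (fun x => \sum_(t <- [seq t <- A | t \in F])
    (\prod_(i <- t) b i * \prod_(i <- t) X i x))); last first.
  by apply/funext => x; rewrite big_filter.
apply: measurable_sum => t; apply: measurable_funM; first exact: measurable_cst.
by apply: measurable_prod => i _; exact: measurable_funP.
Qed.

Lemma measurable_deviation (S : {RV P >-> R}) A (e : R) :
  measurable [set x | e <= `|S x - chaos_partial_sum X b F A x| ].
Proof.
have mY : measurable_fun setT (fun x => `|S x - chaos_partial_sum X b F A x|).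
  apply: measurableT_comp; first exact: normr_measurable.
  apply: measurable_funB; first exact: measurable_funP.
  exact: measurable_chaos_partial_sum.
have := mY measurableT [set` `[e, +oo[%R] (measurable_itv _); rewrite setTI.
by congr (measurable _); apply/seteqP; split => x /=; rewrite in_itv/= andbT.
Qed.

(** Convergence along the net holds past a finite index set, which all large boxes contain.
    Chebyshev's inequality divides by [e ^+ 2], hence the target [e ^+ 2 * e'] for the second
    moment. *)
Lemma chaos_sum_approx (S : {RV P >-> R}) (e e' : R) : 0 < e -> 0 < e' ->
  is_chaos_sum X b F S -> exists n0, forall n, (n0 <= n)%N ->
  fine (P [set x | e <= `|S x - chaos_partial_sum X b F (box n) x| ]) <= e'.
Proof.
move=> e0 e'0 SF.
have r0 : 0 < e ^+ 2 * e' by rewrite mulr_gt0// exprn_gt0.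
have r0' : (0 < (e ^+ 2 * e')%:E)%E by rewrite lte_fin.
have [A0 _ A0P] : summability.totally [set A | ('E_P[(fun w =>
    (S w - chaos_partial_sum X b F A w) ^+ 2)%R] < (e ^+ 2 * e')%:E)%E].
  exact: (SF _ (open_ereal_lt' r0')).
have [n0 n0P] := entries_bounded (enum_fset A0).
exists n0 => n n0n; pose S_ := chaos_partial_sum X b F (box n).
have box_A0 : (A0 `<=` box n)%fset.
  apply/fsubsetP => t tA0; rewrite seq_fsetE.
  have [|s ->] := @lift_tuple_surj n q t.
    by move=> i it; apply: leq_trans n0n; exact: (n0P t).
  by apply: map_f; rewrite mem_enum.
have mY : (fun w => S w - S_ w) \in mfun.
  apply/mem_set; apply: measurable_funB; first exact: measurable_funP.
  exact: measurable_chaos_partial_sum.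
pose Y : {RV P >-> R} := mfun_Sub mY.
have f0 r : 0 <= r -> 0 <= r ^+ 2 :> R by move=> _; exact: sqr_ge0.
have fnd : {in Num.nneg &, {homo (fun r : R => r ^+ 2) : x y / x <= y}}.
  by move=> x y; rewrite !nnegrE => x0 y0; rewrite ler_sqr.
have mf : measurable_fun setT (fun r : R => r ^+ 2) by exact: measurable_funX.
have := markov Y e0 mf f0 fnd.
rewrite (_ : _ \o _ \o _ = (fun w => (S w - S_ w) ^+ 2)); last first.
  by apply/funext => w /=; rewrite real_normK// num_real.
have PE : P [set x | (e%:E <= `|(Y x)%:E|)%E] =
    (fine (P [set x | e <= `|S x - S_ x|]))%:E.
  rewrite fineK; last by apply: fin_num_measure; exact: measurable_deviation.
  by congr (P _); apply/seteqP; split => x /=; rewrite lee_fin.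
rewrite PE => /le_lt_trans/(_ (A0P _ box_A0)).
by rewrite -EFinM lte_fin ltr_pM2l ?exprn_gt0// => /ltW.
Qed.
End truncation.

Section maximal_influence.
Context {R : realType} (b : nat -> R) (q : nat) (F : set (q.-tuple nat)).
Hypothesis b_summable : square_summable b.
Hypothesis q_gt0 : (0 < q)%N.
Hypothesis F_pos : (0 < mu_pow b F)%E.

Lemma Psi_le1 j : Psi b F j <= 1.
Proof.
rewrite /Psi ler_pdivrMr ?mass_gt0// mul1r.
by apply: fine_le; rewrite ?mu_pow_fin_num//; apply: le_mu_pow => t [].
Qed.

Lemma Psi_le_sup j : Psi b F j <= sup (range (Psi b F)).
Proof.
by apply: ub_le_sup; [exists 1 => _ [k _ <-]; exact: Psi_le1|exists j].
Qed.

Lemma sup_Psi_le1 : sup (range (Psi b F)) <= 1.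
Proof.
apply: ge_sup; first by exists (Psi b F 0%N), 0%N.
by move=> _ [k _ <-]; exact: Psi_le1.
Qed.

(** Its fourth root is the length of the smoothing window, by which the proof divides. Some tuple of
    [F] has positive mass, and it belongs to [Fstar F j] for [j] its first entry. *)
Lemma sup_Psi_gt0 : 0 < sup (range (Psi b F)).
Proof.
have [t [Ft bt]] : exists t, F t /\ 0 < \prod_(i <- t) b i ^+ 2.
  apply: contrapT => /forallNP not_t; move: F_pos.
  rewrite /mu_pow esum1 ?ltxx// => t Ft; congr (_%:E); apply/eqP.
  rewrite eq_le prodr_ge0 ?andbT; last by move=> i _; exact: sqr_ge0.
  by rewrite leNgt; apply/negP => bt; apply: (not_t t).
pose j := tnth t (Ordinal q_gt0).
apply: (lt_le_trans _ (Psi_le_sup j)).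
rewrite divr_gt0 ?(mass_gt0 b_summable F_pos)//.
apply: (lt_le_trans bt); rewrite -lee_fin fineK ?mu_pow_fin_num//.
rewrite -(@esum_set1 _ _ t (fun t => (\prod_(i <- t) b i ^+ 2)%:E)).
  apply: le_mu_pow => _ ->; split=> //=; exact: mem_tnth.
by rewrite lee_fin ltW.
Qed.

End maximal_influence.

Section kolmogorov.
Context {R : realType} {d : measure_display} {T : measurableType d}
  {P : probability T R} (X : nat -> {RV P >-> R}).
Context (b : nat -> R) (q : nat) (F : set (q.-tuple nat)) (S : {RV P >-> R}).
Context {d' : measure_display} {T' : measurableType d'} {P' : probability T' R}
  (N : {RV P' >-> R}).
Hypothesis X_rad : rademacher_sequence X.
Hypothesis q_gt0 : (0 < q)%N.
Hypothesis F_Delta : F `<=` Delta q.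
Hypothesis F_sym : symmetric_set F.
Hypothesis b_summable : square_summable b.
Hypothesis F_pos : (0 < mu_pow b F)%E.
Hypothesis SF : is_chaos_sum X b F S.
Hypothesis N_gauss : standard_gaussian N.

Let delta : R := sup (range (Psi b F)) `^ 4^-1.
Let k : R := normal_peak 1.
(** The first two terms come from [stein_error], [k^-1] from the smoothing error [delta / phi 0],
    and [k] from a shift of the argument by [delta]. *)
Let C2 : R := 2 * 4 ^+ q * q%:R + 4 * (1 + 9 ^+ q) + k^-1 + k.

(** The truncation parameter [e] is independent of [delta] and will tend to 0. The missing variance
    costs [2 * e], the event of a large deviation [e], and the shift of the argument [k * e]. *)
Lemma cdf_difference_approx (x e : R) : 0 < e ->
  `|fine (cdf S x) - fine (cdf N x)| <=
  2 * 4 ^+ q * Phi b F + C2 * delta + (3 + k) * e.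
Proof.
move=> e0; have M0 := mass_gt0 b_summable F_pos.
have k0 : 0 < k by rewrite normal_peak_gt0// oner_neq0.
have delta4 : delta ^+ 4 = sup (range (Psi b F)).
  rewrite -powR_mulrn ?powR_ge0// -powRrM mulVf ?pnatr_eq0// powRr1//.
  exact/ltW/sup_Psi_gt0.
have delta0 : 0 < delta by rewrite powR_gt0// sup_Psi_gt0.
have delta1 : delta <= 1.
  by rewrite -(@expr_le1 _ 4)// ?delta4 ?sup_Psi_le1// ltW.
have eM0 : 0 < e * fine (mu_pow b F) by rewrite mulr_gt0.
have [n0 n0P] := mu_pow_approx b_summable F eM0.
have [n1 n1P] := chaos_sum_approx e0 e0 SF.
pose n := maxn n0 n1; pose a := @coef R b q n F; pose p := cube_poly a.
have a_lo : 1 - e <= \sum_I a I ^+ 2.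
  rewrite sum_coef_sqr// mulrC ler_pdivlMr//.
  under [leRHS]eq_bigl do rewrite andbT.
  by have := n0P n (leq_maxl _ _); lra.
have S_dev := n1P n (leq_maxr _ _).
pose D := [set y | e <= `|S y - chaos_partial_sum X b F (box q n) y| ].
rewrite -/D in S_dev.
have mD : measurable D by exact: measurable_deviation.
have phi0 : 0 <= Phi b F by rewrite /Phi divr_ge0 ?sqrtr_ge0// ltW.
have delta01 : 0 < delta <= 1 by rewrite delta0.
have a_inf j : influence a j <= delta ^+ 4.
  by rewrite delta4; apply: le_trans (Psi_le_sup b_summable F_pos _);
    exact: influence_coef_le.
have a_card I : a I != 0 -> #|I| = q by exact: coef_card.
have a_le1 : \sum_I a I ^+ 2 <= 1 by exact: sum_coef_sqr_le1.
have a_linked : \sum_I \sum_(L | linked a I L) a I ^+ 2 * a L ^+ 2 <=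
    Phi b F ^+ 2 by exact: sum_linked_coef_le.
have approx z := cube_normal_approximation q_gt0 a_card a_le1 delta01 a_inf phi0
  a_linked z (standard_normal_pair_cdf N_gauss).
have err_le : stein_error q a delta (Phi b F) <= 2 * e + 2 * 4 ^+ q * Phi b F +
    (2 * 4 ^+ q * q%:R + 4 * (1 + 9 ^+ q)) * delta.
  by rewrite /stein_error !lerD2r; lra.
have p0 : normal_pdf 0 1 0 = k :> R.
  rewrite normal_pdfE ?oner_eq0// /normal_fun subrr expr0n /= oppr0 mul0r.
  by rewrite expR0 mulr1.
have mS (A : set R) : measurable A -> measurable (S @^-1` A).
  by move=> mA; rewrite -[X in measurable X]setTI; exact: measurable_funP.
have dev_union (B : set T) : measurable B ->
    fine (P (B `|` D)) <= fine (P B) + e.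
  move=> mB; apply: (@le_trans _ _ (fine (P B) + fine (P D))).
    rewrite -fineD ?fin_num_measure//; apply: fine_le.
    - by apply: fin_num_measure; exact: measurableU.
    - by rewrite fin_numD !fin_num_measure.
    - exact: measureU2.
  by rewrite lerD2l.
have mSx : measurable (S @^-1` `]-oo, x]) by exact: mS.
have cdfE : fine (cdf S x) = fine (P (S @^-1` `]-oo, x])) by [].
rewrite ler_norml; apply/andP; split.
(* If [p w <= x - e], then [S <= x] or [S] is at distance at least [e] from its truncation. *)
- have [_ lo] := approx (x - e).
  have : cube_mean (fun w => (p w <= x - e)%R%:R) <= fine (cdf S x) + e.
    rewrite cdfE; apply: le_trans (dev_union _ mSx).
    apply: (cube_mean_le_probability X_rad
      (Q := fun w => p w <= x - e)).
      exact: measurableU.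
    move=> w y pw yw; rewrite /= in_itv /=.
    have [Sx|xS] := leP (S y) x; [by left|right].
    rewrite /D /= (chaos_box b F_Delta F_sym yw).
    by apply: le_trans (ler_norm _); move: pw; rewrite -/a -/p; lra.
  have xe : x - e <= x by lra.
  have := normal_cdf_increment N_gauss xe; rewrite -/k.
  rewrite p0 in lo; rewrite /C2.
  have : k * (x - (x - e)) = k * e by ring.
  have : delta / k = k^-1 * delta by rewrite mulrC.
  have : 0 <= k * delta by rewrite mulr_ge0// ltW.
  by move: lo; rewrite -/p; lra.
(* Cube means bound probabilities from below, so this side goes through the complement of the
   half-line. Evaluating at [x + e + delta] compensates the shift by [delta] in the one-sided
   estimate. *)
- have [hi _] := approx (x + e + delta).
  rewrite (_ : x + e + delta - delta = x + e) in hi; last by ring.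
  have : cube_mean (fun w => (x + e < p w)%R%:R) <= 1 - fine (cdf S x) + e.
    have -> : 1 - fine (cdf S x) = fine (P (~` (S @^-1` `]-oo, x]))).
      by rewrite cdfE probability_setC// fineB ?fin_num_measure.
    apply: le_trans (dev_union _ (measurableC mSx)).
    apply: (cube_mean_le_probability X_rad (Q := fun w => x + e < p w)).
      by apply: measurableU => //; exact: measurableC.
    move=> w y pw yw; rewrite /= in_itv /=.
    have [Sx|xS] := leP (S y) x; [right|by left].
    rewrite /D /= (chaos_box b F_Delta F_sym yw) distrC.
    by apply: le_trans (ler_norm _); move: pw; rewrite -/a -/p; lra.
  have -> : cube_mean (fun w => (x + e < p w)%R%:R) =
      1 - cube_mean (fun w => (p w <= x + e)%R%:R) :> R.
    transitivity (@cube_mean R 'I_n (fun w => 1 - (p w <= x + e)%R%:R)).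
      by apply: eq_cube_mean => w; case: leP; rewrite ?subrr ?subr0.
    by rewrite cube_meanB cube_mean_cst.
  have xe : x <= x + e + delta by lra.
  have := normal_cdf_increment N_gauss xe; rewrite -/k /C2.
  have : k * (x + e + delta - x) = k * e + k * delta by ring.
  have : 0 <= k^-1 * delta by rewrite mulr_ge0 ?invr_ge0// ltW.
  by move: hi; rewrite -/p; lra.
Qed.

Lemma kolmogorov_distance_le : kolmogorov_distance S N <=
  2 * 4 ^+ q * Phi b F + C2 * delta.
Proof.
have k0 : 0 <= k by exact: normal_peak_ge0.
apply: ge_sup; first by exists `|fine (cdf S 0) - fine (cdf N 0)|, 0.
move=> _ [x _ <-]; apply/ler_addgt0Pr => e e0.
have k3 : 0 < 3 + k by lra.
have e3 : 0 < e / (3 + k) by rewrite divr_gt0.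
have := cdf_difference_approx x e3.
by rewrite [(3 + k) * _]mulrC divfK// gt_eqF.
Qed.

End kolmogorov.

Theorem theorem6p2 (R : realType) (q : nat) (hq : (2 <= q)%N) :
  exists C1 C2 : R, [/\ 0 < C1, 0 < C2 &
    forall (d : measure_display) (T : measurableType d) (P : probability T R)
      (X : nat -> {RV P >-> R}) (F : set (q.-tuple nat)) (b : nat -> R)
      (S : {RV P >-> R})
      (d' : measure_display) (T' : measurableType d') (P' : probability T' R)
      (N : {RV P' >-> R}),
    rademacher_sequence X ->
    F `<=` Delta q -> F !=set0 -> symmetric_set F ->
    square_summable b ->
    (0 < mu_pow b F)%E ->
    is_chaos_sum X b F S ->
    standard_gaussian N ->
    kolmogorov_distance S N <=
      C1 * Phi b F + C2 * (sup (range (Psi b F))) `^ (4^-1)].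
Proof.
have q0 : (0 < q)%N by exact: leq_trans hq.
pose k : R := normal_peak 1.
have k0 : 0 < k by rewrite normal_peak_gt0// oner_neq0.
exists (2 * 4 ^+ q), (2 * 4 ^+ q * q%:R + 4 * (1 + 9 ^+ q) + k^-1 + k); split.
- by rewrite mulr_gt0// exprn_gt0.
- have c4 : 0 <= 2 * 4 ^+ q * q%:R :> R by rewrite !mulr_ge0 ?exprn_ge0.
  have c9 : 0 <= 4 * (1 + 9 ^+ q) :> R by rewrite mulr_ge0 ?addr_ge0 ?exprn_ge0.
  by have := invr_gt0 k; rewrite k0; lra.
- move=> d T P X F b S d' T' P' N X_rad FD _ F_sym b_sum F_pos SF gN.
  exact: (kolmogorov_distance_le X_rad).
Qed.
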